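(* Let $(X,d_X)$ be a metric space and $(X,d_X,T)$ be an integral current space. If $(Y,d_Y)$ is a metric space and there is a bi-Lipschitz map $\psi:X\to Y$, then $(Y,d_Y,\psi_\#T)$ is also an integral current space.
   Context: Currents (Ambrosio–Kirchheim). An $n$-dimensional current $T$ on a complete metric space $(X,d)$ is a real-valued multilinear functional on tuples $(f,\pi_1,\dots,\pi_n)$, $f:X\to\mathbb R$ bounded Lipschitz and $\pi_i:X\to\mathbb R$ Lipschitz, such that: (locality) $T(f,\pi)=0$ if some $\pi_i$ is constant on a neighborhood of $\{f\ne0\}$; (continuity) $T$ is continuous with respect to pointwise convergence of the $\pi_i$ with $\mathrm{Lip}(\pi_i)\le1$; (finite mass) there is a finite Borel measure $\mu$ on $X$ with $|T(f,\pi)|\le\prod_i\mathrm{Lip}(\pi_i)\int_X|f|\,d\mu$. The smallest such $\mu$ is the mass measure $\|T\|_d$; the mass is $\mathbf M(T)=\|T\|_d(X)$. The boundary is $\partial T(f,\pi_1,\dots,\pi_{n-1})=T(1,f,\pi_1,\dots,\pi_{n-1})$. For a Lipschitz map $\varphi:X\to Y$ of complete metric spaces, $\varphi_\#T(f,\pi_1,\dots,\pi_n)=T(f\circ\varphi,\pi_1\circ\varphi,\dots,\pi_n\circ\varphi)$. For $\theta\in L^1(U,\mathbb Z)$, $U\subseteq\mathbb R^n$, $\llbracket\theta\rrbracket(f,\pi)=\int_U\theta f\,d\pi_1\wedge\dots\wedge d\pi_n$. $T$ is integer rectifiable if $T=\sum_{i=1}^\infty\varphi_{i\#}\llbracket\theta_i\rrbracket$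 with mass $\mathbf M(T)=\sum_i\mathbf M(\varphi_{i\#}\llbracket\theta_i\rrbracket)$, where $\varphi_i:U_i\to X$ are countably many bi-Lipschitz maps with pairwise disjoint images, $U_i\subset\mathbb R^n$ precompact Borel, $\theta_i\in L^1(U_i,\mathbb Z)$. $T$ is an integral current if it is integer rectifiable and $\partial T$ is a current. The canonical set is $\mathrm{set}_d(T)=\{p:\liminf_{r\to0}\|T\|_d(B_r(p))/(\omega_nr^n)>0\}$, $\omega_n$ the volume of the unit ball in $\mathbb R^n$. $(X,d,T)$ is an ($n$-dimensional) integral current space if $(X,d)$ is a metric space and $T$ is an $n$-dimensional integral current on the completion $(\overline X,\overline d)$ with $\mathrm{set}_d(T)=X$. In the claim, $\psi_\#T$ is the pushforward under the extension $\overline X\to\overline Y$ of $\psi$ to the completions.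
   Formalization: The bi-Lipschitz map ψ: X→Y is assumed to be surjective; without this the claim fails, since set(ψ_#T)=ψ(X) must equal Y (e.g. the inclusion of [0,1] in [0,2]). *)

(* Defs.v *)
From HB Require Import structures.
From mathcomp Require Import all_boot all_order all_algebra.
From mathcomp Require Import all_classical all_reals all_analysis.
From mathcomp Require Import measurable_realfun.
Import Order.TTheory GRing.Theory Num.Theory numFieldNormedType.Exports.
Set Implicit Arguments. Unset Strict Implicit. Unset Printing Implicit Defensive.
Local Open Scope classical_set_scope.
Local Open Scope ring_scope.

Section rV_lebesgue.
Context {R : realType}.

(* R^n with its Borel sets. *)
Definition borel_rV (n : nat) := g_sigma_algebraType (@open 'rV[R]_n).
HB.instance Definition _ n := Measurable.on (borel_rV n).

Definition row_cons n (p : measurableTypeR R * borel_rV n) : borel_rV n.+1 :=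
  \row_i oapp (fun j => (p.2 : 'rV[R]_n) 0 j) (p.1 : R) (unlift ord0 i).

Definition row_uncons n (v : borel_rV n.+1) : measurableTypeR R * borel_rV n :=
  ((v : 'rV[R]_n.+1) 0 0, \row_j (v : 'rV[R]_n.+1) 0 (lift ord0 j)).

Lemma row_consK n : cancel (@row_cons n) (@row_uncons n).
Proof.
case=> t v; rewrite /row_uncons /row_cons /= mxE unlift_none /=.
by congr (_, _); apply/rowP => j; rewrite !mxE liftK.
Qed.

Lemma row_unconsK n : cancel (@row_uncons n) (@row_cons n).
Proof.
move=> v; apply/rowP => i; rewrite mxE /row_uncons /=.
by case: unliftP => [j|] ->; rewrite /= ?mxE.
Qed.

Lemma measurable_coord n (j : 'I_n) :
  measurable_fun [set: borel_rV n] (fun v => (v : 'rV[R]_n) 0 j : measurableTypeR R).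
Proof.
apply: (measurability _ (RGenOpens.measurableE R)) => _ [_ [a [b ->] <-]].
rewrite setTI; apply: sub_sigma_algebra => /=.
apply: open_comp; last exact: interval_open.
by move=> x _; exact: coord_continuous.
Qed.

Lemma measurable_rV d (T : measurableType d) n (h : T -> borel_rV n) :
  (forall j, measurable_fun setT (fun t => (h t : 'rV[R]_n) 0 j : measurableTypeR R)) ->
  measurable_fun setT h.
Proof.
move=> mh.
apply: (@measurability _ _ _ _ setT h (@open 'rV[R]_n)) => //.
move=> _ [V oV <-]; rewrite setTI.
pose B (q : 'rV[rat]_n * nat) : set 'rV[R]_n :=
  [set x | forall j, `|ratr (q.1 0 j) - x 0 j| < q.2.+1%:R^-1].
pose F q := if `[< B q `<=` V >] then h @^-1` B q else set0.
have -> : h @^-1` V = \bigcup_q F q.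
  apply/seteqP; split=> [t /= Vht|t [q _]]; last first.
    by rewrite /F; case: asboolP => // + /=; exact.
  have /nbhs_ballP[e /= e0 eV] : nbhs (h t : 'rV[R]_n) V by exact: open_nbhs_nbhs.
  have [k ke] : exists k : nat, k.+1%:R^-1 < e / 2.
    exists (Num.truncn (e / 2)^-1).
    rewrite invf_plt ?posrE ?divr_gt0//.
    exact: truncnS_gt.
  have /choice[q qh] : forall j : 'I_n, exists q : rat, `|ratr q - (h t : 'rV[R]_n) 0 j| < k.+1%:R^-1.
    move=> j; have := @rat_in_itvoo R ((h t : 'rV[R]_n) 0 j - k.+1%:R^-1) ((h t : 'rV[R]_n) 0 j + k.+1%:R^-1).
    have k0 : 0 < k.+1%:R^-1 :> R by rewrite invr_gt0.
    rewrite -subr_gt0 opprD addrACA subrr add0r opprK addr_gt0// => /(_ isT)[q].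
    rewrite in_itv/= => /andP[q1 q2]; exists q.
    by rewrite distrC ltr_distlC q1 q2.
  exists (\row_j q j, k) => //; rewrite /F.
  have Bh : B (\row_j q j, k) (h t) by move=> j /=; rewrite mxE.
  case: asboolP => // -[] x Bx; apply: eV; split => // i j.
  rewrite ord1 /ball/=.
  have := Bx j; have := Bh j => /= H1 H2.
  rewrite -[X in X < _]/(`| _ - _|) (splitr e).
  rewrite -(subrKA (ratr ((\row_j q j) 0 j))) (le_lt_trans (ler_normD _ _))// ltrD//.
    by rewrite distrC (lt_trans H1).
  by rewrite (lt_trans H2).
apply: countable_bigcupT_measurable; first exact: countableP.
move=> q; rewrite /F; case: asboolP => // _.
rewrite (_ : _ @^-1` _ = \bigcap_(j in [set: 'I_n])
   (fun t => (h t : 'rV[R]_n) 0 j : measurableTypeR R) @^-1` (ball (ratr (q.1 0 j) : R) q.2.+1%:R^-1)).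
  apply: fin_bigcap_measurable; first exact: finite_finset.
  move=> j _; rewrite -[X in measurable X]setTI; apply: mh => //.
  exact: measurable_ball.
by apply/seteqP; split => t /= H j; [move=> _|]; have := H j => //; exact.
Qed.

Lemma measurable_row_cons n : measurable_fun setT (@row_cons n).
Proof.
apply: (@measurable_rV _ _ n.+1 (@row_cons n)) => i; case: (unliftP ord0 i) => [j|] ->.
- rewrite (_ : (fun t => _) = (fun v => (v : 'rV[R]_n) 0 j : measurableTypeR R) \o snd).
    exact: (measurableT_comp (measurable_coord j) measurable_snd).
  by apply/funext => t; rewrite mxE liftK.
- rewrite (_ : (fun t => _) = fst); first exact: measurable_fst.
  by apply/funext => t; rewrite mxE unlift_none.
Qed.

Lemma measurable_row_uncons n : measurable_fun setT (@row_uncons n).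
Proof.
apply: measurable_fun_pair; first exact: measurable_coord.
apply: (@measurable_rV _ _ n (snd \o @row_uncons n)) => j; rewrite (_ : (fun t => _) = (fun v => (v : 'rV[R]_n.+1) 0 (lift ord0 j))).
  exact: measurable_coord.
by apply/funext => v; rewrite mxE.
Qed.

Section step.
Variables (n : nat) (mu : {sigma_finite_measure set (borel_rV n) -> \bar R}).

Definition lebesgue_step : set (borel_rV n.+1) -> \bar R :=
  pushforward (lebesgue_measure \x mu)%E (@row_cons n).

Let lebesgue_step0 : lebesgue_step set0 = 0%E.
Proof. by rewrite /lebesgue_step /pushforward preimage_set0 measure0. Qed.

Let lebesgue_step_ge0 A : (0 <= lebesgue_step A)%E.
Proof. by rewrite /lebesgue_step /pushforward; exact: (measure_ge0 (lebesgue_measure \x mu)%E). Qed.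

Let lebesgue_step_sigma_additive : semi_sigma_additive lebesgue_step.
Proof.
have mcons A : measurable A -> measurable (@row_cons n @^-1` A).
  by move=> mA; rewrite -[X in measurable X]setTI; exact: measurable_row_cons.
move=> F mF tF mUF; rewrite /lebesgue_step /pushforward preimage_bigcup.
apply: measure_semi_sigma_additive => [k||].
- exact: mcons.
- apply/trivIsetP => /= i j _ _ ij; rewrite -preimage_setI.
  by move/trivIsetP : tF => /(_ _ _ _ _ ij) ->//; rewrite preimage_set0.
- by rewrite -preimage_bigcup; exact: mcons.
Qed.

HB.instance Definition _ := isMeasure.Build _ _ _ lebesgue_step
  lebesgue_step0 lebesgue_step_ge0 lebesgue_step_sigma_additive.

Let lebesgue_step_sigma_finite : sigma_finite setT lebesgue_step.
Proof.
have /sigma_finiteP[F [TF ndF Foo]] := sigma_finiteT (@lebesgue_measure R).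
have /sigma_finiteP[G [TG ndG Goo]] := sigma_finiteT mu.
exists (fun k => @row_uncons n @^-1` (F k `*` G k)).
  apply/seteqP; split=> // v _.
  have [i _ Fi] : (\bigcup_i F i) (row_uncons v).1 by rewrite -TF.
  have [j _ Gj] : (\bigcup_i G i) (row_uncons v).2 by rewrite -TG.
  exists (maxn i j) => //; split.
    by move: Fi; exact/subsetPset/ndF/leq_maxl.
  by move: Gj; exact/subsetPset/ndG/leq_maxr.
move=> k; have [mFk Fkoo] := Foo k; have [mGk Gkoo] := Goo k; split.
  rewrite -[X in measurable X]setTI; apply: measurable_row_uncons => //.
  exact: measurableX.
rewrite /lebesgue_step /pushforward -comp_preimage.
rewrite (_ : _ \o _ = id); last by apply/funext => x; exact: row_consK.
by rewrite preimage_id product_measure1E// lte_mul_pinfty// ge0_fin_numE.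
Qed.

HB.instance Definition _ := Measure_isSigmaFinite.Build _ _ _ lebesgue_step
  lebesgue_step_sigma_finite.
End step.

(* Lebesgue measure on R^n, through R^(n+1) = R x R^n; on R^0 it is the Dirac
   mass. *)
Fixpoint lebesgue n : {sigma_finite_measure set (borel_rV n) -> \bar R} :=
  if n is m.+1 then lebesgue_step (lebesgue m)
  else dirac ((0 : 'rV[R]_0) : borel_rV 0).

Lemma lebesgue_box n (A : 'I_n -> set (measurableTypeR R)) :
  (forall j, measurable (A j)) ->
  lebesgue n [set x | forall j, A j ((x : 'rV[R]_n) 0 j)] =
  (\prod_j lebesgue_measure (A j))%E.
Proof.
elim: n A => [|n IHn] A mA.
  by rewrite big_ord0 /= diracE mem_set// => -[].
rewrite big_ord_recl -IHn//= -product_measure1E//.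
  rewrite /lebesgue_step /pushforward; congr (product_measure1 _ _ _).
  apply/seteqP; split => [[t v]/= H|[t v]/= [H0 H] j].
    split=> [|j].
      by have := H ord0; rewrite mxE unlift_none.
    by have := H (lift ord0 j); rewrite mxE liftK.
  by rewrite mxE; case: unliftP => [k|] ->.
rewrite (_ : mkset _ = \bigcap_(j in [set: 'I_n])
   (fun x => (x : 'rV[R]_n) 0 j : measurableTypeR R) @^-1` A (lift ord0 j)).
  apply: fin_bigcap_measurable; first exact: finite_finset.
  move=> j _; rewrite -[X in measurable X]setTI; exact: measurable_coord.
by apply/seteqP; split => t /= H j; [move=> _|]; have := H j => //; exact.
Qed.
End rV_lebesgue.

Section lipschitz.
Context {R : realType} {A B : Type}.
Variables (dA : A -> A -> R) (dB : B -> B -> R) (D : set A) (f : A -> B).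

Definition lipschitz_with (K : R) :=
  0 <= K /\ forall x y, D x -> D y -> dB (f x) (f y) <= K * dA x y.

Definition is_lipschitz := exists K, lipschitz_with K.

Definition lip_const : R := inf [set K | lipschitz_with K].

Definition bilipschitz := exists2 L, 0 < L &
  forall x y, D x -> D y -> dA x y / L <= dB (f x) (f y) <= L * dA x y.

End lipschitz.

Section euclidean.
Context {R : realType} {n : nat}.

Definition rdist (s t : R) : R := `|s - t|.

(* The norm of 'rV[R]_n in the library is the sup norm, whence the same
   topology; metric notions on R^n refer to the Euclidean distance below. *)
Definition edist (x y : 'rV[R]_n) : R :=
  Num.sqrt (\sum_j (x 0 j - y 0 j) ^+ 2).

Definition unit_ball_volume : R :=
  fine (lebesgue n [set x : 'rV[R]_n | edist 0 x < 1]).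

(* The McShane extension to R^n of a Lipschitz function g on U, with the same
   Lipschitz constant. *)
Definition mcshane (U : set 'rV[R]_n) (g : 'rV[R]_n -> R) (x : 'rV[R]_n) : R :=
  inf [set g u + lip_const edist rdist U g * edist u x | u in U].

End euclidean.
Arguments unit_ball_volume {R} n.

Section functionals.
Context {R : realType}.

(* Currents are total functions; only their values at tuples (f, p) with f
   bounded Lipschitz and all p i Lipschitz are meaningful. *)
Definition functional (X : Type) (n : nat) :=
  (X -> R) -> ('I_n -> X -> R) -> R.

Definition push_current (X Y : Type) n (phi : X -> Y) (T : functional X n) :
    functional Y n :=
  fun f p => T (f \o phi) (fun i => p i \o phi).

Definition boundary (X : Type) n (T : functional X n.+1) : functional X n :=
  fun f p => T (fun=> 1) (fun i => oapp p f (unlift ord0 i)).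

(* The differentials of Lipschitz functions p i on U exist almost everywhere on
   U, and are almost everywhere those of any Lipschitz extension to R^n. *)
Definition int_current n (U : set 'rV[R]_n) (theta : 'rV[R]_n -> int) :
    functional 'rV[R]_n n :=
  fun f p => \int[lebesgue n]_(x in U)
    ((theta x)%:~R * f x *
     \det (\matrix_(i, j) 'D_(delta_mx 0 j) (mcshane U (p i)) x)).

End functionals.

Section currents.
Context {R : realType}.
Implicit Type X : metricType R.

Definition lip X (p : X -> R) := is_lipschitz mdist rdist setT p.

Definition Lip X (p : X -> R) : R := lip_const mdist rdist setT p.

Definition bounded_lip X (f : X -> R) :=
  (exists M, forall x, `|f x| <= M) /\ lip f.

(* Measurable types are pointed, but a metric space may be empty. A Borel
   measure on X is therefore a measure on the disjoint union option X of X and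
   a point, for the Borel sets, that does not charge the additional point. *)
Definition borel X := g_sigma_algebraType [set Some @` V | V in @open X].
HB.instance Definition _ X := Measurable.on (borel X).

Definition mass_bound X n (T : functional X n)
    (mu : {measure set (borel X) -> \bar R}) :=
  [/\ (mu setT < +oo)%E, mu [set None] = 0%E &
    forall f p, bounded_lip f -> (forall i, lip (p i)) ->
      (`|T f p|%:E <= (\prod_i Lip (p i))%:E *
        \int[mu]_x (oapp (fun y => `|f y|) 0 x)%:E)%E].

Record is_current X n (T : functional X n) : Prop := {
  current_linear_fun : forall (a : R) f g p,
    bounded_lip f -> bounded_lip g -> (forall i, lip (p i)) ->
    T (fun x => a * f x + g x) p = a * T f p + T g p;
  current_linear_coord : forall (i : 'I_n) (a : R) f p g h,
    bounded_lip f -> (forall j, lip (p j)) -> lip g -> lip h ->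
    T f (fun j => if j == i then fun x => a * g x + h x else p j) =
    a * T f (fun j => if j == i then g else p j) +
    T f (fun j => if j == i then h else p j);
  current_local : forall f p, bounded_lip f -> (forall i, lip (p i)) ->
    (exists (i : 'I_n) (V : set X) (c : R),
      [/\ open V, [set x | f x != 0] `<=` V & forall x, V x -> p i x = c]) ->
    T f p = 0;
  current_continuous : forall f (p : nat -> 'I_n -> X -> R) (q : 'I_n -> X -> R),
    bounded_lip f ->
    (forall k i, lipschitz_with mdist rdist setT (p k i) 1) ->
    (forall i, lipschitz_with mdist rdist setT (q i) 1) ->
    (forall i x, p k i x @[k --> \oo] --> q i x) ->
    T f (p k) @[k --> \oo] --> T f q;
  current_finite_mass : exists mu, mass_bound T mu }.

Definition is_mass_measure X n (T : functional X n)
    (mu : {measure set (borel X) -> \bar R}) :=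
  mass_bound T mu /\
  forall nu : {measure set (borel X) -> \bar R}, mass_bound T nu ->
    forall A, measurable A -> (mu A <= nu A)%E.

(* ||T||, as a function of Borel subsets of X; it is determined by T on these. *)
Definition mass_measure X n (T : functional X n) (A : set X) : \bar R :=
  if pselect (exists mu, is_mass_measure T mu) is left h
  then projT1 (cid h) (Some @` A) else 0%E.

Definition mass X n (T : functional X n) : \bar R := mass_measure T setT.

Definition canonical_set X n (T : functional X n) : set X :=
  [set x | (0 < limf_einf (fun r : R => mass_measure T (ball x r) *
      ((unit_ball_volume n * r ^+ n)^-1)%:E) (0 : R)^'+)%E].

Record chart X n := Chart {
  chart_dom : set 'rV[R]_n;
  chart_mult : 'rV[R]_n -> int;
  chart_map : 'rV[R]_n -> X }.

Definition is_chart X n (c : chart X n) :=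
  [/\ measurable (chart_dom c : set (borel_rV n)),
      precompact (chart_dom c),
      (lebesgue n).-integrable (chart_dom c)
        (fun x => ((chart_mult c x)%:~R : R)%:E) &
      bilipschitz edist mdist (chart_dom c) (chart_map c)].

Definition chart_current X n (c : chart X n) : functional X n :=
  push_current (chart_map c) (int_current (chart_dom c) (chart_mult c)).

Definition chart_image X n (c : chart X n) : set X :=
  chart_map c @` chart_dom c.

(* A countable family of charts is a sequence with possibly missing terms; over
   the empty space there is no chart at all. *)
Definition integer_rectifiable X n (T : functional X n) :=
  exists c : nat -> option (chart X n),
  [/\ forall k, if c k is Some d then is_chart d else True,
      trivIset setT (fun k => oapp (@chart_image X n) set0 (c k)),
      forall f p, bounded_lip f -> (forall i, lip (p i)) ->
        (fun N => \sum_(k < N) oapp (fun d => chart_current d f p) 0 (c k))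
          @ \oo --> T f p &
      mass T = (\sum_(k <oo) oapp (fun d => mass (chart_current d)) 0 (c k))%E].

(* There is no condition on the boundary of a 0-dimensional current. *)
Definition boundary_is_current X n : functional X n -> Prop :=
  if n is m.+1 then fun T => is_current (boundary T) else fun=> True.

Definition integral_current X n (T : functional X n) :=
  [/\ is_current T, integer_rectifiable T & boundary_is_current T].

Definition complete_space X := forall F : set_system X,
  ProperFilter F -> cauchy F -> exists x : X, F --> x.

Definition is_completion (X Xb : metricType R) (i : X -> Xb) :=
  [/\ forall x y, mdist (i x) (i y) = mdist x y, dense (range i) &
      complete_space Xb].

(* X is identified with its image in its completion Xb. *)
Definition integral_current_space (X Xb : metricType R) (i : X -> Xb) n (T : functional Xb n) :=
  [/\ is_completion i, integral_current T & canonical_set T = range i].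

End currents.

(* Main.v *)
(* The map extends to a bi-Lipschitz homeomorphism of the completions, under
   which currents, boundaries and charts transport. The delicate clause of
   rectifiability is that the mass of the pushforward is again the sum of the
   masses of the pushed charts. For this, a functional that is linear in f and
   has a finite mass bound has a least one: f can be cut along a Borel set B by
   Lipschitz approximations of the indicator of B, so two bounds can be glued
   along B, which makes the infimum of all bounds additive. By the same cutting,
   the mass of a convergent sum of functionals concentrated on disjoint Borel
   sets is the sum of their masses; a chart current is concentrated on the image
   of its chart, which is Borel. Finally a pushforward along an L-Lipschitz map
   increases the mass measure at most by the factor L^n, and applying this to
   the map and to its inverse compares the lower densities that define the
   canonical sets. *)
From HB Require Import structures.
Require Import Defs.
From mathcomp Require Import all_boot all_order perm all_algebra.
From mathcomp Require Import all_classical all_reals all_analysis.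
From mathcomp Require Import measurable_realfun ring lra.
(* [edist] also names an extended distance of the library. *)
Import Defs.
Import Order.TTheory GRing.Theory Num.Theory numFieldNormedType.Exports.
Set Implicit Arguments. Unset Strict Implicit. Unset Printing Implicit Defensive.
Local Open Scope classical_set_scope.
Local Open Scope ring_scope.

(** * Lipschitz functions *)

(** The obstacle is that a bi-Lipschitz map only compares masses up to a factor L^n, while
    rectifiability asks for an equality of masses. So the equality cannot be transported from [T];
    it is derived afresh from the disjointness of the pushed chart images. The mass clause of [T]
    serves only to make the sum of the pushed masses finite: term by term it is at most L^n times
    the sum for [T]. For a chart current the argument needs some finite bound concentrated on the
    chart image, not its exact mass. A crude one is enough, with the constant n! L^n: n! terms in
    the Leibniz formula of the Jacobian, and one factor L for each coordinate. The least bound lies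
    below it and is therefore concentrated on the same set. Pushing a chart amounts to composing its
    map with [psi], with domain and multiplicity unchanged: [int_current] sees a function only
    through its pullback to the chart domain, so the pushed chart current is the pushforward by
    unfolding. The infimum of all bounds, taken set by set, is not obviously a bound itself. This is
    settled by comparing total masses, after replacing |f| by M - |f|. *)

Section lipschitz_with.
Context {R : realType} {A : Type} (d : A -> A -> R) (D : set A).
Hypothesis d_ge0 : forall x y, 0 <= d x y.

Lemma lipschitz_withW (f : A -> R) K K' : K <= K' ->
  lipschitz_with d rdist D f K -> lipschitz_with d rdist D f K'.
Proof.
move=> KK' [K0 fK]; split; first exact: le_trans KK'.
by move=> x y Dx Dy; rewrite (le_trans (fK _ _ Dx Dy))// ler_wpM2r.
Qed.

(** Holds for every [f]: without any Lipschitz constant the infimum is that of the empty set, which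
    is 0 by convention. *)
Lemma lip_const_ge0 (f : A -> R) : 0 <= lip_const d rdist D f.
Proof.
rewrite /lip_const; have [[K fK]|S0] := pselect (exists K, lipschitz_with d rdist D f K).
  by apply: lb_le_inf; [exists K | move=> y []].
rewrite (_ : [set K | _] = set0) ?inf0//.
by apply/seteqP; split=> // K fK; apply: S0; exists K.
Qed.

Lemma lip_const_le (f : A -> R) K :
  lipschitz_with d rdist D f K -> lip_const d rdist D f <= K.
Proof. by move=> fK; apply: ge_inf => //; exists 0 => y []. Qed.

(** The infimum is attained, because at each fixed pair of points the inequality is a closed
    condition on K. Pairs at distance 0 are treated apart, since there one cannot divide by the
    distance. *)
Lemma lipschitz_lip_const (f : A -> R) : is_lipschitz d rdist D f ->
  lipschitz_with d rdist D f (lip_const d rdist D f).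
Proof.
move=> [K fK]; split; first exact: lip_const_ge0.
move=> x y Dx Dy; have := d_ge0 x y; rewrite le_eqVlt => /predU1P[d0|dp].
  by have := fK.2 _ _ Dx Dy; rewrite -d0 !mulr0.
rewrite -ler_pdivrMr//; apply: lb_le_inf; first by exists K.
by move=> k [k0 /(_ _ _ Dx Dy)]; rewrite ler_pdivrMr.
Qed.

End lipschitz_with.

Section lip.
Context {R : realType} {X : metricType R}.
Implicit Types f g : X -> R.

Lemma lip_continuous f : lip f -> continuous f.
Proof.
move=> [K [K0 fK]] x; apply/cvgrPdist_lt => /= e e0.
near=> y; have := fK x y I I; rewrite /rdist => /le_lt_trans; apply.
rewrite (@le_lt_trans _ _ ((K + 1) * mdist x y))//.
  by rewrite ler_wpM2r ?mdist_ge0 ?lerDl.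
rewrite mulrC -ltr_pdivlMr ?ltr_wpDl//.
near: y; have := @nbhsx_ballx _ X x (e / (K + 1)).
by rewrite ballEmdist; apply; rewrite divr_gt0 ?ltr_wpDl.
Unshelve. all: by end_near. Qed.

Lemma lipschitz_with_Lip f : lip f -> lipschitz_with mdist rdist setT f (Lip f).
Proof. by apply: lipschitz_lip_const => x y; exact: mdist_ge0. Qed.

Lemma Lip_ge0 f : 0 <= Lip f.
Proof. exact: lip_const_ge0. Qed.

Lemma prod_Lip_ge0 n (p : 'I_n -> X -> R) : 0 <= \prod_i Lip (p i).
Proof. by apply: prodr_ge0 => i _; exact: Lip_ge0. Qed.

Lemma lip_cst (c : R) : lip (fun _ : X => c).
Proof.
by exists 0; split=> // x y _ _; rewrite /rdist subrr normr0 mul0r.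
Qed.

Lemma lip_lin (a : R) f g : lip f -> lip g -> lip (fun x => a * f x + g x).
Proof.
move=> [K [K0 fK]] [L [L0 gL]]; exists (`|a| * K + L); split.
  by rewrite addr_ge0// mulr_ge0.
move=> x y _ _; rewrite /rdist opprD addrACA -mulrBr mulrDl.
rewrite (le_trans (ler_normD _ _))// lerD//; last exact: gL.
by rewrite normrM -mulrA ler_wpM2l//; exact: fK.
Qed.

Lemma lipB f g : lip f -> lip g -> lip (fun x => f x - g x).
Proof.
move=> lf lg; have := lip_lin (-1) lg lf; congr lip; apply/funext => x.
by rewrite mulN1r addrC.
Qed.

Lemma lip_norm f : lip f -> lip (fun x => `|f x|).
Proof.
move=> [K [K0 fK]]; exists K; split=> // x y _ _.
by rewrite /rdist (le_trans (ler_dist_dist _ _))//; exact: fK.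
Qed.

(** From max(f, g) = (f + g + |f - g|) / 2. *)
Lemma lip_max f g : lip f -> lip g -> lip (fun x => Num.max (f x) (g x)).
Proof.
move=> lf lg.
have := lip_lin 2^-1 (lip_lin 1 lf lg) (lip_lin 2^-1 (lip_norm (lipB lf lg)) (lip_cst 0)).
congr lip; apply/funext => x; rewrite mul1r addr0 -mulrDr mulrC.
case: (leP (f x) (g x)) => fg.
  by rewrite ler0_norm ?subr_le0//; field.
by rewrite gtr0_norm ?subr_gt0//; field.
Qed.

Lemma bounded_lipM f g : bounded_lip f -> bounded_lip g ->
  bounded_lip (fun x => f x * g x).
Proof.
move=> [[M fM] [K [K0 fK]]] [[N gN] [L [L0 gL]]]; split.
  by exists (M * N) => x; rewrite normrM ler_pM.
(* Absolute values, because over an empty space the bounds M and N may be negative. *)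
exists (`|M| * L + `|N| * K); split; first by rewrite addr_ge0// mulr_ge0.
move=> x y _ _; rewrite /rdist.
have -> : f x * g x - f y * g y = f x * (g x - g y) + g y * (f x - f y) by ring.
rewrite (le_trans (ler_normD _ _))// mulrDl !normrM -!mulrA lerD//.
  by apply: ler_pM => //; [rewrite (le_trans (fM _))// ler_norm|exact: gL].
by apply: ler_pM => //; [rewrite (le_trans (gN _))// ler_norm|exact: fK].
Qed.

End lip.

(** * Borel measures on a metric space *)

Section borel.
Context {R : realType} {X : metricType R}.

Lemma measurable_Some_open (V : set X) : open V ->
  measurable (Some @` V : set (borel X)).
Proof. by move=> oV; apply: sub_sigma_algebra; exists V. Qed.

Lemma measurable_None : measurable ([set None] : set (borel X)).
Proof.
have -> : [set None] = ~` (Some @` [set: X] : set (borel X)).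
  by apply/seteqP; split=> [_ -> [x _]//|[x|//] h]; exfalso; apply: h; exists x.
by apply: measurableC; apply: measurable_Some_open; exact: openT.
Qed.

Lemma measurable_oapp (g : X -> R) : continuous g ->
  measurable_fun setT (fun o : borel X => oapp g 0 o : measurableTypeR R).
Proof.
move=> cg; apply: (measurability _ (RGenOpens.measurableE R)).
move=> _ [_ [a [b ->] <-]]; rewrite setTI.
have oV : open (g @^-1` `]a, b[%classic).
  by apply: open_comp => //; exact: interval_open.
(* The additional point takes the value 0, so it belongs to the preimage exactly when the interval
   contains 0. *)
have [ab0|ab0] := pselect (`]a, b[%classic (0 : R)).
  rewrite (_ : _ @^-1` _ = (Some @` (g @^-1` `]a, b[%classic)) `|` [set None]).
    by apply: measurableU; [exact: measurable_Some_open|exact: measurable_None].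
  apply/seteqP; split=> [[x|] h|o].
  - by left; exists x.
  - by right.
  - by case=> [[x h <-]|->].
rewrite (_ : _ @^-1` _ = (Some @` (g @^-1` `]a, b[%classic))).
  exact: measurable_Some_open.
by apply/seteqP; split=> [[x|]// h|_ [x h <-]//]; exists x.
Qed.

Lemma measurable_to_borel d (T : measurableType d) (D : set T) (h : T -> borel X) :
  measurable D ->
  (forall V : set X, open V -> measurable (D `&` h @^-1` (Some @` V))) ->
  measurable_fun D h.
Proof.
move=> mD mh; apply: (@measurability _ _ _ _ D h [set Some @` V | V in @open X]) => //.
by move=> _ [_ [V oV <-] <-]; exact: mh.
Qed.

Lemma measurable_EFin_oapp (g : X -> R) : continuous g ->
  measurable_fun setT (fun o : borel X => (oapp g 0 o)%:E).
Proof. by move=> /measurable_oapp mg; apply/measurable_EFinP. Qed.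

(* The pointwise error of g as an approximation of the indicator of B; the
   additional point of [borel X] is ignored. *)
Definition indic_error (B : set (borel X)) (g : X -> R) (o : borel X) : \bar R :=
  (oapp (fun x => `|g x - \1_B (Some x)|) 0 o)%:E.

Lemma indic_error_ge0 B g o : (0 <= indic_error B g o)%E.
Proof. by rewrite lee_fin; case: o => [x|]/=. Qed.

Lemma measurable_indic_error B g : measurable B -> continuous g ->
  measurable_fun setT (indic_error B g).
Proof.
move=> mB cg; apply/measurable_EFinP.
(* The indicator of X as a second factor forces the value 0 at the additional point, whether or not
   B contains that point. *)
apply: (@eq_measurable_fun _ _ _ _ setT (fun o : borel X =>
    `|oapp g 0 o - \1_B o| * \1_(Some @` [set: X]) o)).
  move=> [x|] _ /=; rewrite [\1_(_ @` _) _]indicE.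
    by rewrite mem_set ?mulr1//; exists x.
  by rewrite memNset ?mulr0//; case.
apply: measurable_funM.
  apply: measurableT_comp => //; apply: measurable_funB; first exact: measurable_oapp.
  exact: measurable_indic.
by apply: measurable_indic; apply: measurable_Some_open; exact: openT.
Qed.

(* As k grows, this increases to the indicator of V. *)
Definition open_bump (V : set X) (k : R) (x : X) : R :=
  inf ([set 1] `|` [set k * mdist x y | y in ~` V]).

Section open_bump.
Variables (V : set X) (k : R).
Hypothesis k0 : 0 <= k.

Let lb0 x : lbound ([set 1] `|` [set k * mdist x y | y in ~` V]) 0.
Proof. by move=> _ [->//|[y _ <-]]; rewrite mulr_ge0// mdist_ge0. Qed.

Let neb x : [set 1] `|` [set k * mdist x y | y in ~` V] !=set0.
Proof. by exists 1; left. Qed.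

Lemma open_bump_ge0 x : 0 <= open_bump V k x.
Proof. by apply: lb_le_inf => //; exact: lb0. Qed.

Lemma open_bump_le1 x : open_bump V k x <= 1.
Proof. by apply: ge_inf; [exists 0; exact: lb0|left]. Qed.

Lemma open_bump_eq0 x : ~ V x -> open_bump V k x = 0.
Proof.
move=> Vx; apply/eqP; rewrite eq_le open_bump_ge0 andbT.
apply: ge_inf; [by exists 0; exact: lb0|right; exists x => //].
by rewrite mdistxx mulr0.
Qed.

Lemma open_bump_eq1 x (r : R) : ball x r `<=` V -> 1 <= k * r -> open_bump V k x = 1.
Proof.
move=> xrV kr; apply/eqP; rewrite eq_le open_bump_le1/=.
apply: lb_le_inf => // _ [->//|[y Vy <-]]; rewrite (le_trans kr)// ler_wpM2l//.
by rewrite leNgt; apply/negP => xyr; apply: Vy; apply: xrV; rewrite ballEmdist.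
Qed.

Lemma lip_open_bump : lip (open_bump V k).
Proof.
have H x y : open_bump V k x <= k * mdist x y + open_bump V k y.
  rewrite -lerBlDl; apply: lb_le_inf => // _ [->|[z Vz <-]]; rewrite lerBlDl.
    by rewrite (le_trans (open_bump_le1 _))// lerDr mulr_ge0// mdist_ge0.
  rewrite -mulrDr; apply: (@le_trans _ _ (k * mdist x z)).
    by apply: ge_inf; [exists 0; exact: lb0|right; exists z].
  by rewrite ler_wpM2l// metric_triangle.
exists k; split=> // x y _ _; rewrite /rdist ler_norml.
by rewrite lerBlDr H lerBrDl lerBlDr addrC metric_sym H.
Qed.

End open_bump.

End borel.

Lemma content_measure d (T : measurableType d) (R : realType) (nu : set T -> \bar R) :
  nu set0 = 0%E -> (forall A, 0 <= nu A)%E -> semi_sigma_additive nu ->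
  exists mu : {measure set T -> \bar R}, forall A, mu A = nu A.
Proof.
move=> nu0 nu_ge0 nus.
pose m := isMeasure.Build _ _ _ nu nu0 nu_ge0 nus.
pose mu : {measure set T -> \bar R} := HB.pack nu m.
by exists mu.
Qed.

Import HBNNSimple.

(** The integral of a nonnegative function is a supremum over simple functions below it, and on each
    of these the comparison is a finite sum; [f] may be arbitrary. *)
Lemma le_measure_integral d (T : measurableType d) (R : realType)
    (m1 m2 : {measure set T -> \bar R}) (f : T -> \bar R) :
  (forall A, measurable A -> m1 A <= m2 A)%E -> (forall x, 0 <= f x)%E ->
  (\int[m1]_x f x <= \int[m2]_x f x)%E.
Proof.
move=> m12 f0; rewrite !ge0_integralTE//.
apply: ge_ereal_sup => _ [h hf <-].
apply: (@le_trans _ _ (sintegral m2 h)); last by apply: ereal_sup_ubound; exists h.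
rewrite !sintegralE; apply: lee_fsum => // x [y _ <-].
by apply: lee_wpmul2l; [rewrite lee_fin; exact: fun_ge0|exact: m12].
Qed.

Lemma glue_measure d (T : measurableType d) (R : realType)
    (mu nu : {measure set T -> \bar R}) (B : set T) : measurable B ->
  exists m : {measure set T -> \bar R},
    forall A, m A = (mu (A `&` B) + nu (A `&` ~` B))%E.
Proof.
move=> mB; have mBC : measurable (~` B) by exact: measurableC.
by exists (measure_add (mrestr mu mB) (mrestr nu mBC)) => A; exact: measure_addE.
Qed.

(** Continuity from above: the tails decrease to the empty set, and finiteness of [mu] allows
    passing to the limit. *)
Lemma finite_measure_cvg_tail d (T : measurableType d) (R : realType)
    (mu : {measure set T -> \bar R}) (F : (set T)^nat) :
  (mu setT < +oo)%E -> (forall k, measurable (F k)) ->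
  mu (\bigcup_k F k `\` \bigcup_(k in `I_n) F k) @[n --> \oo] --> 0%E.
Proof.
move=> mu_fin mF; pose G n := \bigcup_(k in `I_n) F k.
have mG n : measurable (G n) by apply: bigcup_measurable.
have mU : measurable (\bigcup_k F k) by exact: bigcup_measurable.
have : mu (\bigcup_k F k `\` G N) @[N --> \oo] --> mu (\bigcap_N (\bigcup_k F k `\` G N)).
  apply: nonincreasing_cvg_mu => //.
  - by rewrite (le_lt_trans _ mu_fin)// le_measure ?inE//; exact: measurableD.
  - by move=> n; exact: measurableD.
  - by apply: bigcap_measurable => // n _; exact: measurableD.
  - move=> i j ij; apply/subsetPset; apply: setDS.
    by apply: bigcup_sub => k ki; apply: bigcup_sup; exact: leq_trans ij.
rewrite (_ : \bigcap_N _ = set0) ?measure0//.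
apply/seteqP; split=> // o h; have [[k _ Fk] _] := h 0%N I.
by have [_] := h k.+1 I; apply; exists k => //=.
Qed.

(** * Approximation of Borel sets by Lipschitz functions *)

(** Lets a single g cut a function in two: g goes with B, 1 - g with its complement, at the same
    error. *)
Lemma indic_errorC {R : realType} {X : metricType R} (B : set (borel X)) (g : X -> R) :
  indic_error (~` B) (fun x => 1 - g x) = indic_error B g.
Proof.
apply/funext => -[x|]; rewrite /indic_error//=; congr (_%:E).
rewrite indicC/= /setC/= !indicE; case: (Some x \in B) => /=.
all: by rewrite -normrN; congr `|_|; ring.
Qed.

Section lip_approx.
Context {R : realType} {X : metricType R}.
Variable mu : {measure set (borel X) -> \bar R}.
Hypothesis mu_fin : (mu setT < +oo)%E.

Definition lip_approx (B : set (borel X)) := forall e : R, 0 < e ->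
  exists g : X -> R, [/\ lip g, forall x, 0 <= g x <= 1 &
    (\int[mu]_o indic_error B g o <= e%:E)%E].

Lemma finite_measure_lty A : measurable A -> (mu A < +oo)%E.
Proof.
by move=> mA; rewrite (le_lt_trans _ mu_fin)// le_measure ?inE.
Qed.

Lemma lip_approx_setC B : measurable B -> lip_approx B -> lip_approx (~` B).
Proof.
move=> mB aB e e0; have [g [lg g01 ge]] := aB e e0.
exists (fun x => 1 - g x); split.
- exact: lipB (lip_cst _) lg.
- by move=> x; have := g01 x; lra.
- by rewrite indic_errorC.
Qed.

(** For values in [0, 1], the error of max(f, g) for the union is pointwise at most the sum of the
    two errors. *)
Lemma lip_approx_setU A B : measurable A -> measurable B ->
  lip_approx A -> lip_approx B -> lip_approx (A `|` B).
Proof.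
move=> mA mB aA aB e e0.
have e20 : 0 < e / 2 by rewrite divr_gt0.
have [f [lf f01 fe]] := aA _ e20; have [g [lg g01 ge]] := aB _ e20.
exists (fun x => Num.max (f x) (g x)); split.
- exact: lip_max.
- by move=> x; rewrite maxEle; case: ifP => _; [exact: g01|exact: f01].
- rewrite (splitr e) EFinD (le_trans _ (leeD fe ge))//.
  rewrite -ge0_integralD//; first last.
  + exact: measurable_indic_error (lip_continuous lg).
  + by move=> *; exact: indic_error_ge0.
  + exact: measurable_indic_error (lip_continuous lf).
  + by move=> *; exact: indic_error_ge0.
  apply: ge0_le_integral => //.
  + by move=> *; exact: indic_error_ge0.
  + apply: measurable_indic_error; first exact: measurableU.
    exact: lip_continuous (lip_max lf lg).
  + apply: emeasurable_funD.
      exact: measurable_indic_error (lip_continuous lf).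
    exact: measurable_indic_error (lip_continuous lg).
  + move=> [x|] _; rewrite /indic_error/= -EFinD lee_fin ?addr0// !indicE in_setU.
    have N1 (t : R) : 0 <= t <= 1 -> `|t - 1| = 1 - t.
      by move=> t01; rewrite ler0_norm; lra.
    have N0 (t : R) : 0 <= t <= 1 -> `|t - 0| = t.
      by move=> t01; rewrite subr0 ger0_norm; lra.
    have := f01 x; have := g01 x.
    case: (Some x \in A); case: (Some x \in B) => /=; case: (leP (f x) (g x)) => h f1 g1;
      rewrite ?N1 ?N0//; lra.
Qed.

(** Dominated convergence, with the constant 1 as integrable bound. The bumps vanish off V, and at a
    point of V that has a ball of radius r inside V they equal 1 as soon as k r >= 1. *)
Lemma lip_approx_open (V : set X) : open V -> lip_approx (Some @` V).
Proof.
move=> oV e e0.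
have mV := measurable_Some_open oV.
pose f (k : nat) := indic_error (Some @` V) (open_bump V k%:R).
have cf : (\int[mu]_o f k o)%E @[k --> \oo] --> 0%E.
  rewrite -(integral0 mu setT).
  have := @dominated_cvg _ _ R mu setT measurableT f (cst 0%E) (cst 1%E).
  apply => //.
  - move=> k; apply: measurable_indic_error => //.
    by apply: lip_continuous; exact: lip_open_bump.
  - move=> [x|] _ /=; last by apply: cvg_near_cst; exists 0%N.
    have [Vx|Vx] := pselect (V x); last first.
      apply: cvg_near_cst; exists 0%N => // k _.
      rewrite /f /indic_error/= open_bump_eq0// indicE memNset.
        by rewrite subrr normr0.
      by case=> y Vy [yx]; apply: Vx; rewrite -yx.
    have /nbhs_ballP[r /= r0 xrV] : nbhs x V by exact: open_nbhs_nbhs.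
    apply: cvg_near_cst; exists (Num.truncn r^-1).+1 => // k /= rk.
    rewrite /f /indic_error/= (@open_bump_eq1 _ _ _ _ _ x r)//.
      rewrite indicE mem_set ?subrr ?normr0//; by exists x.
    rewrite -ler_pdivrMr// mul1r (le_trans (ltW (truncnS_gt _)))//.
    by rewrite ler_nat.
  - apply/integrableP; split; first exact: measurable_cst.
    by under eq_integral do rewrite abse1; rewrite integral_cst// mul1e.
  - move=> k [x|] _ /=; rewrite /f /indic_error/= ?normr0 ?lee_fin ?ler01//.
    have := @open_bump_ge0 R X V k%:R (ler0n _ _) x.
    have := @open_bump_le1 R X V k%:R (ler0n _ _) x.
    rewrite indicE normr_id; case: (_ \in _) => /=; rewrite ?subr0 => ? ?.
      by rewrite ler0_norm; lra.
    by rewrite ger0_norm; lra.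
have /fine_cvgP[[N1 _ h1] /cvgrPdist_le /(_ e e0)[N2 _ h2]] := cf.
pose N := maxn N1 N2; exists (open_bump V N%:R); split.
- exact: lip_open_bump.
- by move=> x; rewrite open_bump_ge0 ?ler0n// open_bump_le1.
- have := h2 N (leq_maxr _ _); rewrite /= sub0r normrN.
  rewrite -[X in (X <= _)%E](fineK (h1 N (leq_maxl _ _))) lee_fin.
  exact/le_trans/ler_norm.
Qed.

(** Half of the error pays for approximating a finite subunion, the other half for the measure of
    what this subunion misses. *)
Lemma lip_approx_bigcup (F : (set (borel X))^nat) : (forall k, measurable (F k)) ->
  (forall k, lip_approx (F k)) -> lip_approx (\bigcup_k F k).
Proof.
move=> mF aF e e0.
pose G N := \big[setU/set0]_(k < N) F k.
have mG N : measurable (G N) by exact: bigsetU_measurable.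
have aG N : lip_approx (G N).
  elim: N => [|N IH].
    rewrite /G big_ord0 -(@image_set0 _ _ Some); apply: lip_approx_open; exact: open0.
  by rewrite /G big_ord_recr/=; apply: lip_approx_setU => //; exact: mG.
have mUF : measurable (\bigcup_k F k) by exact: bigcup_measurable.
have cG : mu (\bigcup_k F k `\` G N) @[N --> \oo] --> 0%E.
  rewrite (_ : (fun N => _) = (fun N => mu (\bigcup_k F k `\` \bigcup_(k in `I_N) F k))).
    exact: finite_measure_cvg_tail.
  by apply/funext => N; rewrite /G -bigcup_mkord.
have e20 : 0 < e / 2 by rewrite divr_gt0.
have /fine_cvgP[[N1 _ h1] /cvgrPdist_le /(_ _ e20)[N2 _ h2]] := cG.
pose N := maxn N1 N2.
have muN : (mu (\bigcup_k F k `\` G N) <= (e / 2)%:E)%E.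
  have := h2 N (leq_maxr _ _); rewrite /= sub0r normrN.
  rewrite -[X in (X <= _)%E](fineK (h1 N (leq_maxl _ _))) lee_fin.
  exact/le_trans/ler_norm.
have [g [lg g01 ge]] := aG N _ e20.
exists g; split=> //.
rewrite (splitr e) EFinD (le_trans _ (leeD ge muN))//.
have mD : measurable (\bigcup_k F k `\` G N) by exact: measurableD.
rewrite -[X in mu X]setIT -integral_indic// -ge0_integralD//; first last.
- by apply/measurable_EFinP; exact: measurable_indic.
- exact: measurable_indic_error (lip_continuous lg).
- by move=> *; exact: indic_error_ge0.
have GU : G N `<=` \bigcup_k F k.
  by rewrite /G -bigcup_mkord; apply: bigcup_sub => k _; exact: bigcup_sup.
apply: ge0_le_integral => //.
- by move=> *; exact: indic_error_ge0.
- exact: measurable_indic_error (lip_continuous lg).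
- apply: emeasurable_funD.
    exact: measurable_indic_error (lip_continuous lg).
  by apply/measurable_EFinP; exact: measurable_indic.
- move=> [x|] _; rewrite /indic_error/= -EFinD lee_fin ?addr_ge0// !indicE.
  rewrite in_setD -[_ \in G N]negbK.
  case: (boolP (Some x \in G N)) => /= [|_].
    by rewrite inE => /GU h; rewrite mem_set//= addr0.
  have := g01 x; rewrite andbT; case: (_ \in _) => /= x01; rewrite subr0 ?addr0//.
  by rewrite ler0_norm ?ger0_norm; lra.
Qed.

(** The approximable Borel sets form a sigma-algebra containing the open sets. Measurability is
    carried along because the closure lemmas assume it. *)
Lemma measurable_lip_approx B : measurable B -> lip_approx B.
Proof.
suff : <<s [set Some @` V | V in @open X] >> `<=` [set B | measurable B /\ lip_approx B].
  by move=> + mB => /(_ B mB)[].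
apply: smallest_sub; last by move=> _ [V oV <-]; split;
  [exact: measurable_Some_open|exact: lip_approx_open].
split.
- split=> //; rewrite -(@image_set0 _ _ Some); apply: lip_approx_open; exact: open0.
- move=> A [mA aA]; rewrite setTD; split; first exact: measurableC.
  exact: lip_approx_setC.
- move=> F mF; split; first by apply: bigcup_measurable => k _; exact: (mF k).1.
  by apply: lip_approx_bigcup => k; [exact: (mF k).1|exact: (mF k).2].
Qed.

End lip_approx.

(** * Existence of the mass measure *)

Section mass_bound.
Context {R : realType} {X : metricType R}.
Local Open Scope ereal_scope.
Implicit Types (mu nu : {measure set (borel X) -> \bar R}) (f g : X -> R).

Definition ext_norm f (o : borel X) : \bar R := (oapp (fun y => `|f y|)%R 0%R o)%:E.

Lemma ext_norm_ge0 f o : 0 <= ext_norm f o.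
Proof. by rewrite lee_fin; case: o => [x|]/=. Qed.

Lemma measurable_ext_norm f : lip f -> measurable_fun setT (ext_norm f).
Proof.
by move=> lf; apply: measurable_EFin_oapp; apply: lip_continuous; exact: lip_norm.
Qed.

Lemma integral_ext_norm_lty mu f : mu setT < +oo -> bounded_lip f ->
  \int[mu]_o ext_norm f o < +oo.
Proof.
move=> mu_fin [[M fM] lf].
apply: (@le_lt_trans _ _ (\int[mu]_o (`|M|)%:E)).
  apply: ge0_le_integral => //.
  - by move=> *; exact: ext_norm_ge0.
  - exact: measurable_ext_norm.
  - move=> [x|] _; rewrite lee_fin//=.
    exact: le_trans (fM x) (ler_norm _).
by rewrite integral_cst// lte_mul_pinfty// lee_fin.
Qed.

(** On B one has |g f| <= |f|; off B the indicator is 0, so |g f| is at most M times the error of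
    g. *)
Lemma le_integral_ext_norm_cutoff mu (B : set (borel X)) (M : R) f g :
  measurable B -> bounded_lip f -> (forall x, `|f x| <= M)%R -> (0 <= M)%R ->
  lip g -> (forall x, 0 <= g x <= 1)%R ->
  \int[mu]_o ext_norm (fun x => g x * f x)%R o <=
  \int[mu]_(o in B) ext_norm f o + M%:E * \int[mu]_o indic_error B g o.
Proof.
move=> mB bf fM M0 lg g01.
have bg : bounded_lip g.
  by split=> //; exists 1%R => x; have /andP[h1 h2] := g01 x; rewrite ger0_norm.
have me := measurable_indic_error mB (lip_continuous lg).
rewrite [X in _ <= X + _]integral_mkcond -ge0_integralZl_EFin//; last first.
  by move=> *; exact: indic_error_ge0.
rewrite -ge0_integralD//; first last.
- exact: measurable_funeM.
- by move=> *; rewrite mule_ge0// indic_error_ge0.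
- by apply/(measurable_restrictT _ _).1 => //; apply: measurable_funTS;
    exact: measurable_ext_norm bf.2.
- by move=> x _; apply: erestrict_ge0 => *; exact: ext_norm_ge0.
apply: ge0_le_integral => //.
- by move=> *; exact: ext_norm_ge0.
- exact: measurable_ext_norm (bounded_lipM bg bf).2.
- apply: emeasurable_funD; last exact: measurable_funeM.
  by apply/(measurable_restrictT _ _).1 => //; apply: measurable_funTS;
    exact: measurable_ext_norm bf.2.
move=> [x|] _; last first.
  by rewrite /indic_error/= mule0 adde0; apply: erestrict_ge0 => *; exact: ext_norm_ge0.
have /andP[g0 g1] := g01 x.
rewrite patchE /indic_error/= indicE; case: (boolP (Some x \in B)) => _ /=.
  rewrite -[leLHS]adde0 leeD// ?mule_ge0// lee_fin/= normrM.
  by rewrite ger0_norm// ler_piMl.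
rewrite add0e -EFinM lee_fin/= subr0 normrM mulrC.
by rewrite ler_pM.
Qed.

End mass_bound.

Section mass_measure.
Context {R : realType} {X : metricType R} {n : nat}.
Variable S : @functional R X n.
Local Open Scope ereal_scope.
Implicit Types (mu nu : {measure set (borel X) -> \bar R}).

(** Isolated from [is_current] so that the theory of the mass also covers chart currents, for which
    this clause is the linearity of the integral. *)
Definition fun_linear := forall (a : R) f g p,
  bounded_lip f -> bounded_lip g -> (forall i, lip (p i)) ->
  S (fun x => a * f x + g x)%R p = (a * S f p + S g p)%R.

Hypothesis S_linear : fun_linear.

(** Write f = g f + (1 - g) f with g close to the indicator of B, estimate the first term by [mu]
    and the second by [nu], and let the error tend to 0. *)
Lemma mass_bound_glue_le mu nu (B : set (borel X)) f p : measurable B ->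
  mass_bound S mu -> mass_bound S nu -> bounded_lip f -> (forall i, lip (p i)) ->
  `|S f p|%:E <= (\prod_i Lip (p i))%:E *
    (\int[mu]_(o in B) ext_norm f o + \int[nu]_(o in ~` B) ext_norm f o).
Proof.
move=> mB [mu_fin mu0 muS] [nu_fin nu0 nuS] bf lp.
have [[M' fM'] lf] := bf; pose M := `|M'|%R.
have M0 : (0 <= M)%R by exact: normr_ge0.
have fM x : (`|f x| <= M)%R by exact: le_trans (fM' x) (ler_norm _).
set C := (\prod_i _)%R; have C0 : (0 <= C)%R by exact: prod_Lip_ge0.
apply/lee_addgt0Pr => e e0.
(* Each of the two terms costs C M [del]; the 1 keeps the denominator positive when C M = 0. *)
pose del := (e / (2 * (C * M + 1)))%R.
have CM : (0 < C * M + 1)%R by rewrite ltr_wpDl// mulr_ge0.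
have del0 : (0 < del)%R by rewrite divr_gt0// mulr_gt0.
have msum_fin : measure_add mu nu setT < +oo.
  by rewrite measure_addE lte_add_pinfty.
(* Approximating with respect to [mu] + [nu] makes the same g good for both measures. *)
have [g [lg g01 ge]] := measurable_lip_approx msum_fin mB del0.
have me := measurable_indic_error mB (lip_continuous lg).
have bg : bounded_lip g.
  by split=> //; exists 1%R => x; have /andP[h1 h2] := g01 x; rewrite ger0_norm.
pose h x := (1 - g x)%R.
have lh : lip h by exact: lipB (lip_cst _) lg.
have h01 x : (0 <= h x <= 1)%R by have := g01 x; rewrite /h; lra.
have bh : bounded_lip h.
  by split=> //; exists 1%R => x; have /andP[? ?] := h01 x; rewrite ger0_norm.
have -> : S f p = (S (fun x => g x * f x) p + S (fun x => h x * f x) p)%R.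
  rewrite -[X in (X + _)%R]mul1r -S_linear//; last exact: bounded_lipM; last exact: bounded_lipM.
  by congr S; apply/funext => x; rewrite /h; ring.
move: ge; rewrite ge0_integral_measure_add//; last first.
  by move=> *; exact: indic_error_ge0.
move=> ge.
have E0 (m : {measure set (borel X) -> \bar R}) : 0 <= \int[m]_o indic_error B g o.
  by apply: integral_ge0 => *; exact: indic_error_ge0.
have gem : \int[mu]_o indic_error B g o <= del%:E.
  by apply: le_trans ge; rewrite leeDl.
have gen : \int[nu]_o indic_error B g o <= del%:E.
  by apply: le_trans ge; rewrite leeDr.
have hen : \int[nu]_o indic_error (~` B) h o <= del%:E.
  by rewrite indic_errorC.
have H1 := le_integral_ext_norm_cutoff mu mB bf fM M0 lg g01.
have H2 := le_integral_ext_norm_cutoff nu (measurableC mB) bf fM M0 lh h01.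
have K1 : `|S (fun x => g x * f x)%R p|%:E <=
    C%:E * (\int[mu]_(o in B) ext_norm f o + (M * del)%:E).
  apply: (le_trans (muS _ _ (bounded_lipM bg bf) lp)).
  apply: lee_wpmul2l; first by rewrite lee_fin.
  by apply: (le_trans H1); rewrite leeD2l// EFinM lee_wpmul2l// lee_fin.
have K2 : `|S (fun x => h x * f x)%R p|%:E <=
    C%:E * (\int[nu]_(o in ~` B) ext_norm f o + (M * del)%:E).
  apply: (le_trans (nuS _ _ (bounded_lipM bh bf) lp)).
  apply: lee_wpmul2l; first by rewrite lee_fin.
  by apply: (le_trans H2); rewrite leeD2l// EFinM lee_wpmul2l// lee_fin.
have I0 (m : {measure set (borel X) -> \bar R}) D : 0 <= \int[m]_(o in D) ext_norm f o.
  by apply: integral_ge0 => *; exact: ext_norm_ge0.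
apply: (@le_trans _ _ (`|S (fun x => g x * f x)%R p|%:E + `|S (fun x => h x * f x)%R p|%:E)).
  by rewrite -EFinD lee_fin ler_normD.
apply: (le_trans (leeD K1 K2)).
have Md : 0 <= (M * del)%:E by rewrite lee_fin mulr_ge0// ltW.
rewrite (ge0_muleDr _ (I0 _ _) Md) (ge0_muleDr _ (I0 _ _) Md).
rewrite (ge0_muleDr _ (I0 _ _) (I0 _ _)).
rewrite addeACA leeD2l// -EFinM -EFinD lee_fin /del.
have -> : (C * (M * (e / (2 * (C * M + 1)))) + C * (M * (e / (2 * (C * M + 1)))) =
  e * (C * M / (C * M + 1)))%R by field; rewrite gt_eqF.
rewrite ler_piMr ?(ltW e0)// ler_pdivrMr// mul1r lerDl//.
Qed.

Lemma mass_bound_glue mu nu (B : set (borel X)) : measurable B ->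
  mass_bound S mu -> mass_bound S nu ->
  exists2 m : {measure set (borel X) -> \bar R}, mass_bound S m &
    forall A, m A = mu (A `&` B) + nu (A `&` ~` B).
Proof.
move=> mB Smu Snu; have [mu_fin mu0 muS] := Smu; have [nu_fin nu0 nuS] := Snu.
have mBC : measurable (~` B) by exact: measurableC.
have fin (m : {measure set (borel X) -> \bar R}) A : m setT < +oo ->
    measurable A -> m A < +oo.
  by move=> ? ?; exact: finite_measure_lty.
have [m mE] := glue_measure mu nu mB; exists m => //.
split.
- by rewrite mE !setTI lte_add_pinfty//; exact: fin.
- rewrite mE.
  have /= -> : mu ([set None] `&` B) = 0.
    apply/eqP; rewrite -measure_le0 -mu0 le_measure ?inE//; last exact: measurable_None.
    by apply: measurableI => //; exact: measurable_None.
  have -> : nu ([set None] `&` ~` B) = 0.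
    apply/eqP; rewrite -measure_le0 -nu0 le_measure ?inE//; last exact: measurable_None.
    by apply: measurableI => //; exact: measurable_None.
  by rewrite add0e.
- move=> f p bf lp; apply: le_trans (mass_bound_glue_le mB Smu Snu bf lp) _.
  apply: lee_wpmul2l; first by rewrite lee_fin; exact: prod_Lip_ge0.
  have mf := measurable_ext_norm bf.2.
  rewrite -(setUv B) ge0_integral_setU//; first last.
  + by rewrite disj_set2E setICr.
  + by move=> *; exact: ext_norm_ge0.
  + by rewrite setUv.
  rewrite le_eqVlt; apply/orP; left; apply/eqP; congr (_ + _).
    apply: eq_measure_integral => A mA AB.
    rewrite mE (setIidl AB).
    rewrite (_ : A `&` ~` B = set0) ?measure0 ?adde0//.
    by apply/seteqP; split=> // x [/AB].
  apply: eq_measure_integral => A mA AB.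
  rewrite mE (setIidl AB).
  rewrite (_ : A `&` B = set0) ?measure0 ?add0e//.
  by apply/seteqP; split=> // x [/AB].
Qed.

End mass_measure.

Section exists_mass_measure.
Context {R : realType} {X : metricType R} {n : nat}.
Variable S : @functional R X n.
Local Open Scope ereal_scope.
Hypothesis S_linear : fun_linear S.
Variable mu0 : {measure set (borel X) -> \bar R}.
Hypothesis Smu0 : mass_bound S mu0.

Let nu (A : set (borel X)) : \bar R :=
  ereal_inf [set m A | m in [set m : {measure set (borel X) -> \bar R} | mass_bound S m]].

Let nu_le m A : mass_bound S m -> nu A <= m A.
Proof. by move=> Sm; apply: ereal_inf_lbound; exists m. Qed.

Let nu_ge0 A : 0 <= nu A.
Proof. by apply: le_ereal_inf_tmp => _ [m _ <-]; exact: measure_ge0. Qed.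

Let nu_fin A : measurable A -> nu A \is a fin_num.
Proof.
move=> mA; rewrite ge0_fin_numE//; apply: (le_lt_trans (nu_le A Smu0)).
by apply: finite_measure_lty => //; case: Smu0.
Qed.

Let nu_adherent A (e : R) : measurable A -> (0 < e)%R ->
  exists2 m : {measure set (borel X) -> \bar R}, mass_bound S m & m A <= nu A + e%:E.
Proof.
move=> mA e0; have [_ [m Sm <-] /ltW h] := lb_ereal_inf_adherent e0 (nu_fin mA).
by exists m.
Qed.

Let nu0 : nu set0 = 0.
Proof.
apply/eqP; rewrite eq_le nu_ge0 andbT.
by apply: (le_trans (nu_le _ Smu0)); rewrite measure0.
Qed.

Let nuU A B : measurable A -> measurable B -> A `&` B = set0 ->
  nu (A `|` B) = nu A + nu B.
Proof.
move=> mA mB AB; apply/eqP; rewrite eq_le; apply/andP; split.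
  apply/lee_addgt0Pr => e e0; have e20 : (0 < e / 2)%R by rewrite divr_gt0.
  have [m1 Sm1 h1] := nu_adherent mA e20; have [m2 Sm2 h2] := nu_adherent mB e20.
  have [m Sm mE] := mass_bound_glue S_linear mA Sm1 Sm2.
  apply: (le_trans (nu_le _ Sm)); rewrite mE (splitr e) EFinD addeACA leeD//.
    by apply: le_trans h1; rewrite le_measure ?inE//; apply: measurableI => //; exact: measurableU.
  apply: le_trans h2; rewrite le_measure ?inE//.
    by apply: measurableI; [exact: measurableU|exact: measurableC].
  by move=> x [[|//] Ax /(_ Ax)].
(* Gluing was for the upper bound; here each single bound is additive and dominates [nu] on both
   parts. *)
apply: le_ereal_inf_tmp => _ [m Sm <-]; rewrite measureU//.
by rewrite leeD// nu_le.
Qed.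

Let nu_bigsetU (F : (set (borel X))^nat) N : (forall k, measurable (F k)) ->
  trivIset setT F -> nu (\big[setU/set0]_(k < N) F k) = \sum_(k < N) nu (F k).
Proof.
move=> mF tF; elim: N => [|N IH]; first by rewrite !big_ord0 nu0.
rewrite !big_ord_recr/= nuU ?IH//; first exact: bigsetU_measurable.
rewrite -bigcup_mkord -subset0 => x [[k /= kN Fk] FN].
move/trivIsetP : tF => /(_ k N I I); rewrite neq_ltn kN => /(_ isT) h.
by have : (F k `&` F N) x by []; rewrite h.
Qed.

(** By finite additivity the partial sums differ from the total by [nu] of a tail, and this is
    squeezed to 0 by the finite measure [mu0]. *)
Let nu_sigma : semi_sigma_additive nu.
Proof.
move=> F mF tF mU.
pose G N := \big[setU/set0]_(k < N) F k.
pose D N := \bigcup_k F k `\` G N.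
have mG N : measurable (G N) by exact: bigsetU_measurable.
have mD N : measurable (D N) by exact: measurableD.
have GU N : G N `<=` \bigcup_k F k.
  by rewrite /G -bigcup_mkord; apply: bigcup_sub => k _; exact: bigcup_sup.
have UE N : nu (\bigcup_k F k) - nu (D N) = \sum_(0 <= k < N) nu (F k).
  have -> : nu (\bigcup_k F k) = nu (G N) + nu (D N).
    by rewrite -nuU// ?setDUK// /D setIC setDKI.
  by rewrite -addeA subee ?nu_fin// adde0 nu_bigsetU// big_mkord.
rewrite (_ : (fun N => _) = (fun N => nu (\bigcup_k F k) - nu (D N))); last first.
  by apply/funext => N; rewrite UE.
suff : nu (\bigcup_k F k) - nu (D N) @[N --> \oo] --> nu (\bigcup_k F k) - 0.
  by rewrite sube0.
apply: cvgeB => //; first by rewrite fin_num_adde_defl.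
  exact: cvg_cst.
apply: (@squeeze_cvge _ _ _ _ (cst 0) _ (mu0 \o D)).
- by apply: nearW => N; rewrite nu_ge0 nu_le.
- exact: cvg_cst.
- rewrite (_ : mu0 \o D = fun N => mu0 (\bigcup_k F k `\` \bigcup_(k in `I_N) F k)).
    by apply: finite_measure_cvg_tail => //; case: Smu0.
  by apply/funext => N; rewrite /= /D /G -bigcup_mkord.
Qed.

(** What remains is that the infimum [mu] is itself a bound. Take a bound m whose total mass is
    within [del] of that of [mu]. Since [mu] <= m, the integral of M - |f| >= 0 for [mu] is at most
    that for m; subtracting from M times the total masses shows that the integral of |f| for m
    exceeds that for [mu] by at most M [del]. *)
Lemma exists_mass_measure : exists mu, is_mass_measure S mu.
Proof.
have [mu muE] := content_measure nu0 nu_ge0 nu_sigma.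
have mu_le m A : mass_bound S m -> mu A <= m A by rewrite muE; exact: nu_le.
exists mu; split; last by move=> m Sm A _; exact: mu_le.
have mu_fin : mu setT < +oo.
  by apply: le_lt_trans (mu_le _ _ Smu0) _; case: Smu0.
split => //.
  by apply/eqP; rewrite -measure_le0 (le_trans (mu_le _ _ Smu0))//; case: Smu0 => _ -> _.
move=> f p bf lp; have [[M' fM'] lf] := bf; pose M := `|M'|%R.
have M0 : (0 <= M)%R by exact: normr_ge0.
have fM x : (`|f x| <= M)%R by exact: le_trans (fM' x) (ler_norm _).
set C := (\prod_i _)%R; have C0 : (0 <= C)%R by exact: prod_Lip_ge0.
have mf := measurable_ext_norm lf.
pose g o := M%:E - ext_norm f o.
have g0 o : 0 <= g o.
  by rewrite /g sube_ge0// lee_fin; case: o => [x|]//=.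
have mg : measurable_fun setT g by apply: emeasurable_funB.
have split_M (m : {measure set (borel X) -> \bar R}) : m setT < +oo ->
    M%:E * m setT = \int[m]_o ext_norm f o + \int[m]_o g o.
  move=> m_fin; rewrite -integral_cst//.
  rewrite -ge0_integralD//; last by move=> *; exact: ext_norm_ge0.
  by apply: eq_integral => o _; rewrite /g addeC subeK.
have I_fin (m : {measure set (borel X) -> \bar R}) : m setT < +oo ->
    \int[m]_o ext_norm f o \is a fin_num.
  move=> m_fin; rewrite ge0_fin_numE; first exact: integral_ext_norm_lty.
  by apply: integral_ge0 => *; exact: ext_norm_ge0.
apply/lee_addgt0Pr => e e0.
pose del := (e / (C * M + 1))%R.
have CM : (0 < C * M + 1)%R by rewrite ltr_wpDl// mulr_ge0.
have del0 : (0 < del)%R by rewrite divr_gt0.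
have [m Sm m_le] := nu_adherent measurableT del0.
have [m_fin _ mS] := Sm.
apply: (le_trans (mS _ _ bf lp)).
have gm_ge : \int[mu]_o g o <= \int[m]_o g o.
  by apply: le_measure_integral => // A _; exact: mu_le.
have Im : \int[m]_o ext_norm f o <= \int[mu]_o ext_norm f o + (M * del)%:E.
  have g_fin : \int[m]_o g o \is a fin_num.
    rewrite ge0_fin_numE ?integral_ge0//.
    apply: (@le_lt_trans _ _ (M%:E * m setT)); last by rewrite lte_mul_pinfty ?lee_fin.
    rewrite split_M// leeDr// integral_ge0// => *; exact: ext_norm_ge0.
  rewrite -(leeD2rE _ _ g_fin) -split_M//.
  apply: (@le_trans _ _ (M%:E * (mu setT + del%:E))).
    by apply: lee_wpmul2l; [rewrite lee_fin|rewrite muE].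
  have d0 : 0 <= del%:E by rewrite lee_fin ltW.
  rewrite (ge0_muleDr _ (measure_ge0 mu setT) d0) (split_M mu mu_fin) -EFinM.
  by rewrite addeAC; apply: leeD.
apply: (@le_trans _ _ (C%:E * (\int[mu]_o ext_norm f o + (M * del)%:E))).
  by apply: lee_wpmul2l; rewrite ?lee_fin.
have I0 : 0 <= \int[mu]_o ext_norm f o.
  by apply: integral_ge0 => *; exact: ext_norm_ge0.
have Md : 0 <= (M * del)%:E by rewrite lee_fin mulr_ge0// ltW.
rewrite (ge0_muleDr _ I0 Md) leeD2l// -EFinM lee_fin /del.
rewrite mulrA mulrA [(_ * e)%R]mulrC -mulrA ler_piMr ?(ltW e0)//.
by rewrite ler_pdivrMr// mul1r lerDl.
Qed.

End exists_mass_measure.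

Section mass_measure_lemmas.
Context {R : realType} {X : metricType R} {n : nat}.
Variable S : @functional R X n.
Local Open Scope ereal_scope.

(** [mass_measure] picks some least bound by choice; two least bounds lie below each other, hence
    agree on Borel sets. *)
Lemma mass_measureE mu A : is_mass_measure S mu -> measurable (Some @` A : set (borel X)) ->
  mass_measure S A = mu (Some @` A).
Proof.
move=> Smu mA; rewrite /mass_measure; case: pselect => [h|]; last first.
  by case; exists mu.
move: (projT2 (cid h)); set nu := projT1 _ => Snu.
by apply/eqP; rewrite eq_le Smu.2 ?Snu.2//; [exact: Smu.1|exact: Snu.1].
Qed.

Lemma massE mu : is_mass_measure S mu -> mass S = mu setT.
Proof.
move=> Smu; rewrite /mass (mass_measureE Smu); last first.
  by apply: measurable_Some_open; exact: openT.
have -> : [set: borel X] = Some @` [set: X] `|` [set None].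
  by apply/seteqP; split=> // -[x|] _; [left; exists x|right].
have [[_ mu0 _] _] := Smu.
rewrite measureU//=; last by rewrite -subset0 => _ [[x _ <-]].
- by rewrite mu0 adde0.
- by apply: measurable_Some_open; exact: openT.
- exact: measurable_None.
Qed.

End mass_measure_lemmas.

(** * Additivity of the mass *)

Section mass_series.
Context {R : realType} {X : metricType R} {n : nat}.
Local Open Scope ereal_scope.
Variables (S : @functional R X n) (Sk : nat -> @functional R X n).
Variables (m_ : nat -> {measure set (borel X) -> \bar R}).
Variable E : nat -> set (borel X).
Hypotheses (S_linear : fun_linear S) (Sk_linear : forall k, fun_linear (Sk k)).
Hypothesis Sk_mass : forall k, is_mass_measure (Sk k) (m_ k).
Hypothesis mE : forall k, measurable (E k).
Hypothesis tE : trivIset setT E.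
Hypothesis m_E : forall k, m_ k (~` E k) = 0.
Hypothesis m_lty : \sum_(k <oo) m_ k setT < +oo.
Hypothesis S_lim : forall f p, bounded_lip f -> (forall i, lip (p i)) ->
  (\sum_(k < N) Sk k f p)%R @[N --> \oo] --> S f p.

Let m : {measure set (borel X) -> \bar R} := mseries m_ 0.

Let m_fin : m setT < +oo. Proof. exact: m_lty. Qed.

Let mk_fin k : m_ k setT < +oo.
Proof. by have [[]] := Sk_mass k. Qed.

Let mk_bound k := (Sk_mass k).1.

Let m_ext_norm f : lip f ->
  \int[m]_o ext_norm f o = \sum_(k <oo) \int[m_ k]_o ext_norm f o.
Proof.
move=> lf; apply: ge0_integral_measure_series => //.
- by move=> *; exact: ext_norm_ge0.
- exact: measurable_ext_norm.
Qed.

(* Termwise bounds, summed and passed to the limit. *)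
Let lim_le (u : nat -> R) (l c : R) (r : nat -> \bar R) :
  (forall k, 0 <= r k) -> (0 <= c)%R ->
  (\sum_(k < N) u k)%R @[N --> \oo] --> l ->
  (forall k, `|u k|%:E <= c%:E * r k) ->
  \sum_(k <oo) r k < +oo -> `|l|%:E <= c%:E * \sum_(k <oo) r k.
Proof.
move=> r0 c0 ul ur r_fin.
have s_fin : c%:E * \sum_(k <oo) r k \is a fin_num.
  by rewrite fin_numM// ge0_fin_numE// nneseries_ge0.
rewrite -(fineK s_fin) lee_fin.
have cn : `|\sum_(k < N) u k|%R @[N --> \oo] --> `|l|%R by exact: cvg_norm.
rewrite -(cvg_lim _ cn)//; apply: limr_le; first by apply/cvg_ex; exists `|l|%R.
apply: nearW => N; rewrite -lee_fin (fineK s_fin).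
apply: (@le_trans _ _ (\sum_(0 <= k < N) (c%:E * r k))).
  rewrite big_mkord (le_trans (y := (\sum_(k < N) `|u k|%R)%:E))//.
    by rewrite lee_fin ler_norm_sum.
  by rewrite -sumEFin; apply: lee_sum => k _; exact: ur.
rewrite -ge0_sume_distrr// lee_wpmul2l ?lee_fin//.
exact: nneseries_lim_ge.
Qed.

Lemma mass_bound_series : mass_bound S m.
Proof.
split.
- exact: m_fin.
- by rewrite /m/= /mseries; apply: eseries0 => k _ _; have [[]] := Sk_mass k.
- move=> f p bf lp.
  have fin : \sum_(k <oo) \int[m_ k]_o ext_norm f o < +oo.
    by rewrite -m_ext_norm; [exact: integral_ext_norm_lty|exact: bf.2].
  have := @lim_le (fun k => Sk k f p) _ _ _ _ (prod_Lip_ge0 p) (S_lim bf lp) _ fin.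
  rewrite -m_ext_norm//; last exact: bf.2.
  apply.
  + by move=> k; apply: integral_ge0 => *; exact: ext_norm_ge0.
  + by move=> k; have [_ _] := mk_bound k; apply.
Qed.

Let E_disj j k : j != k -> m_ j (E k) = 0.
Proof.
move=> jk; apply/eqP; rewrite -measure_le0 -(m_E j) le_measure ?inE//.
  exact: measurableC.
move=> o Ek Ej; move/trivIsetP : tE => /(_ j k I I jk) h.
by have : (E j `&` E k) o by []; rewrite h.
Qed.

Let null_ext_norm j (A : set (borel X)) f : measurable A -> lip f -> m_ j A = 0 ->
  \int[m_ j]_(o in A) ext_norm f o = 0.
Proof.
move=> mA lf mA0; apply: null_set_integral => //.
by apply: measurable_funTS; exact: measurable_ext_norm.
Qed.

(** With g close to the indicator of [E k], the value S(g f) nearly isolates the k-th term: the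
    difference S(g f) - S_k(f) consists of S_j(g f) for j != k and of -S_k((1 - g) f). As m_j lives
    on [E j], each is at most C M times the error of g for m_j, and these errors add up to the error
    for [m]. *)
Lemma mass_bound_series_term (nu : {measure set (borel X) -> \bar R}) k f p :
  mass_bound S nu -> bounded_lip f -> (forall i, lip (p i)) ->
  `|Sk k f p|%:E <= (\prod_i Lip (p i))%:E * \int[nu]_(o in E k) ext_norm f o.
Proof.
move=> [nu_fin nu0 nuS] bf lp.
have [[M' fM'] lf] := bf; pose M := `|M'|%R.
have M0 : (0 <= M)%R by exact: normr_ge0.
have fM x : (`|f x| <= M)%R by exact: le_trans (fM' x) (ler_norm _).
set C := (\prod_i _)%R; have C0 : (0 <= C)%R by exact: prod_Lip_ge0.
apply/lee_addgt0Pr => e e0.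
pose del := (e / (2 * (C * M + 1)))%R.
have CM : (0 < C * M + 1)%R by rewrite ltr_wpDl// mulr_ge0.
have del0 : (0 < del)%R by rewrite divr_gt0// mulr_gt0.
have msum_fin : measure_add m nu setT < +oo.
  by rewrite measure_addE lte_add_pinfty.
have [g [lg g01]] := measurable_lip_approx msum_fin (mE k) del0.
have me := measurable_indic_error (mE k) (lip_continuous lg).
have bg : bounded_lip g.
  by split=> //; exists 1%R => x; have /andP[h1 h2] := g01 x; rewrite ger0_norm.
pose h x := (1 - g x)%R.
have lh : lip h by exact: lipB (lip_cst _) lg.
have h01 x : (0 <= h x <= 1)%R by have := g01 x; rewrite /h; lra.
have bh : bounded_lip h.
  by split=> //; exists 1%R => x; have /andP[? ?] := h01 x; rewrite ger0_norm.
rewrite ge0_integral_measure_add//; last first.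
  by move=> *; exact: indic_error_ge0.
move=> ge.
have E0 (mu : {measure set (borel X) -> \bar R}) : 0 <= \int[mu]_o indic_error (E k) g o.
  by apply: integral_ge0 => *; exact: indic_error_ge0.
have gem : \int[m]_o indic_error (E k) g o <= del%:E.
  by apply: le_trans ge; rewrite leeDl.
have gen : \int[nu]_o indic_error (E k) g o <= del%:E.
  by apply: le_trans ge; rewrite leeDr.
have mser : \int[m]_o indic_error (E k) g o =
    \sum_(j <oo) \int[m_ j]_o indic_error (E k) g o.
  apply: ge0_integral_measure_series => //.
  by move=> *; exact: indic_error_ge0.
pose gf x := (g x * f x)%R.
have bgf : bounded_lip gf by exact: bounded_lipM.
(* Subtracting S_k(f) inside the k-th term turns the whole difference into one convergent series, to
   which [lim_le] applies. *)
pose u j := (Sk j gf p - (if j == k then Sk k f p else 0))%R.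
have ul : (\sum_(j < N) u j)%R @[N --> \oo] --> (S gf p - Sk k f p)%R.
  have : (\sum_(j < N) Sk j gf p - Sk k f p)%R @[N --> \oo] --> (S gf p - Sk k f p)%R.
    by apply: cvgB; [exact: S_lim|exact: cvg_cst].
  apply: cvg_trans; apply: near_eq_cvg; exists k.+1 => // N /= kN.
  rewrite /u big_split/=; congr (_ + _)%R; rewrite sumrN; congr (- _)%R.
  rewrite (bigD1 (Ordinal kN))//= eqxx big1 ?addr0// => j jk.
  by rewrite ifF//; apply/negbTE; apply: contra_neq jk => jk; exact: val_inj.
have ub j : `|u j|%:E <= (C * M)%:E * \int[m_ j]_o indic_error (E k) g o.
  rewrite EFinM -muleA; have [_ _ jS] := mk_bound j; rewrite /u.
  case: eqP => [->|/eqP jk].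
    have -> : (Sk k gf p - Sk k f p = - Sk k (fun x => h x * f x) p)%R.
      have := @Sk_linear k 1%R _ _ _ bgf (bounded_lipM bh bf) lp; rewrite mul1r => H.
      rewrite -[X in (_ - X)%R](_ : Sk k (fun x => 1 * gf x + h x * f x)%R p = _).
        by rewrite H opprD addrA subrr add0r.
      by congr Sk; apply/funext => x; rewrite /gf /h; ring.
    rewrite normrN; have [_ _ kS] := mk_bound k.
    apply: (le_trans (kS _ _ (bounded_lipM bh bf) lp)); apply: lee_wpmul2l.
      by rewrite lee_fin.
    apply: le_trans (le_integral_ext_norm_cutoff _ (measurableC (mE k)) bf fM M0 lh h01) _.
    by rewrite null_ext_norm ?m_E//; [rewrite add0e indic_errorC|exact: measurableC].
  rewrite subr0; apply: (le_trans (jS _ _ bgf lp)); apply: lee_wpmul2l.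
    by rewrite lee_fin.
  apply: le_trans (le_integral_ext_norm_cutoff _ (mE k) bf fM M0 lg g01) _.
  by rewrite null_ext_norm ?E_disj// add0e.
have CM0 : (0 <= C * M)%R by rewrite mulr_ge0.
have Ifin : \sum_(j <oo) \int[m_ j]_o indic_error (E k) g o < +oo.
  by rewrite -mser (le_lt_trans gem)// ltry.
have H1 : `|S gf p - Sk k f p|%:E <= (C * M * del)%:E.
  apply: le_trans (@lim_le u _ _ _ (fun j => E0 _) CM0 ul ub Ifin) _.
  by rewrite -mser [leRHS]EFinM; apply: lee_wpmul2l => //; rewrite lee_fin.
have I0 : 0 <= \int[nu]_(o in E k) ext_norm f o.
  by apply: integral_ge0 => *; exact: ext_norm_ge0.
have H2 : `|S gf p|%:E <= C%:E * \int[nu]_(o in E k) ext_norm f o + (C * M * del)%:E.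
  apply: le_trans (nuS _ _ bgf lp) _.
  apply: (@le_trans _ _ (C%:E * (\int[nu]_(o in E k) ext_norm f o + (M * del)%:E))).
    apply: lee_wpmul2l; first by rewrite lee_fin.
    apply: le_trans (le_integral_ext_norm_cutoff _ (mE k) bf fM M0 lg g01) _.
    by rewrite leeD2l// EFinM lee_wpmul2l// lee_fin.
  have Md : 0 <= (M * del)%:E by rewrite lee_fin mulr_ge0// ltW.
  by rewrite (ge0_muleDr _ I0 Md) -EFinM mulrA.
apply: (@le_trans _ _ (`|S gf p|%:E + `|S gf p - Sk k f p|%:E)).
  rewrite -EFinD lee_fin.
  rewrite -[X in (`|X| <= _)%R](subKr (S gf p)).
  exact: ler_normB.
apply: (le_trans (leeD H2 H1)).
rewrite -addeA leeD2l// -EFinD lee_fin /del.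
have -> : (C * M * (e / (2 * (C * M + 1))) + C * M * (e / (2 * (C * M + 1))) =
  e * (C * M / (C * M + 1)))%R by field; rewrite gt_eqF.
by rewrite ler_piMr ?(ltW e0)// ler_pdivrMr// mul1r lerDl.
Qed.

(** The sum of the m_k is a bound for S, which gives one inequality. Conversely, the mass measure of
    S restricted to [E k] bounds S_k, so m_k has total mass at most [nu (E k)], and the [E k] are
    disjoint. *)
Lemma mass_series : mass S = \sum_(k <oo) mass (Sk k).
Proof.
have [nu Snu] := exists_mass_measure S_linear mass_bound_series.
rewrite (massE Snu); under eq_eseriesr do rewrite (massE (Sk_mass _)).
apply/eqP; rewrite eq_le; apply/andP; split.
  exact: (Snu.2 _ mass_bound_series).
have [[nu_fin nu0 nuS] _] := Snu.
have mk_le k : m_ k setT <= nu (E k).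
  pose r := mrestr nu (mE k).
  have Sr : mass_bound (Sk k) r.
    split.
    - by rewrite /r /= /mrestr setTI; exact: finite_measure_lty.
    - apply/eqP; rewrite -measure_le0 -nu0 /r /= /mrestr le_measure ?inE//.
      + by apply: measurableI => //; exact: measurable_None.
      + exact: measurable_None.
    - move=> f p bf lp; apply: le_trans (mass_bound_series_term k Snu.1 bf lp) _.
      apply: lee_wpmul2l; first by rewrite lee_fin; exact: prod_Lip_ge0.
      have -> : \int[nu]_(o in E k) ext_norm f o = \int[r]_(o in E k) ext_norm f o.
        apply: eq_measure_integral => A mA AE.
        by rewrite /r /= /mrestr (setIidl AE).
      apply: ge0_subset_integral => //.
      + exact: measurable_ext_norm bf.2.
      + by move=> *; exact: ext_norm_ge0.
  apply: le_trans ((Sk_mass k).2 _ Sr _ measurableT) _.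
  by rewrite /r /= /mrestr setTI.
apply: (@le_trans _ _ (\sum_(k <oo) nu (E k))).
  by apply: lee_nneseries => // k _.
rewrite -measure_semi_bigcup//; last exact: bigcup_measurable.
by rewrite le_measure ?inE//; exact: bigcup_measurable.
Qed.

End mass_series.

(** * Pushforward along Lipschitz maps *)

Lemma scaled_pushforward d1 d2 (T1 : measurableType d1) (T2 : measurableType d2)
    (R : realType) (mu : {measure set T1 -> \bar R}) (phi : T1 -> T2) (c : R) :
  measurable_fun setT phi -> 0 <= c ->
  exists nu : {measure set T2 -> \bar R},
    (forall A, nu A = c%:E * mu (phi @^-1` A))%E /\
    forall f : T2 -> \bar R, measurable_fun setT f -> (forall y, 0 <= f y)%E ->
      (\int[nu]_y f y = c%:E * \int[mu]_x f (phi x))%E.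
Proof.
move=> mphi c0.
(* The measure structure of [pushforward] takes the measurability of the map
   as an argument. *)
pose push : {measure set T2 -> \bar R} := pushforward mu phi.
pose nu1 := push mphi.
exists (mscale (NngNum c0) nu1); split=> // f mf f0.
rewrite ge0_integral_mscale//=; congr (_ * _)%E.
by rewrite ge0_integral_pushforward//= preimage_setT.
Qed.

Lemma limf_einf_gt0P (R : realType) (f : R -> \bar R) (F : set_system R) :
  (0 < limf_einf f F)%E <-> exists2 V, F V & (0 < ereal_inf (f @` V))%E.
Proof.
rewrite limf_einfE; split=> [/ereal_sup_gt[_ [V FV <-] h]|[V FV h]]; first by exists V.
by apply: lt_le_trans h _; apply: ereal_sup_ubound; exists V.
Qed.

Section push.
Context {R : realType} {X Y : metricType R} {n : nat}.
Variables (psi : X -> Y) (L : R).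
Hypothesis psiL : lipschitz_with mdist mdist setT psi L.

Let L0 : 0 <= L. Proof. by have [] := psiL. Qed.

Lemma lipschitz_with_continuous : continuous psi.
Proof.
move=> x; apply/cvg_ballP => e e0.
near=> y; rewrite ballEmdist/= (le_lt_trans (psiL.2 x y I I))//.
rewrite (@le_lt_trans _ _ ((L + 1) * mdist x y))//.
  by rewrite ler_wpM2r ?mdist_ge0 ?lerDl.
rewrite mulrC -ltr_pdivlMr ?ltr_wpDl//.
near: y; have := @nbhsx_ballx _ X x (e / (L + 1)).
by rewrite ballEmdist; apply; rewrite divr_gt0 ?ltr_wpDl.
Unshelve. all: by end_near. Qed.

Lemma lipschitz_with_comp (f : Y -> R) K : lipschitz_with mdist rdist setT f K ->
  lipschitz_with mdist rdist setT (f \o psi) (K * L).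
Proof.
move=> [K0 fK]; split; first by rewrite mulr_ge0.
move=> x y _ _ /=; rewrite (le_trans (fK _ _ I I))// -mulrA ler_wpM2l//.
exact: psiL.2.
Qed.

Lemma lip_comp (f : Y -> R) : lip f -> lip (f \o psi).
Proof. by move=> [K fK]; exists (K * L); exact: lipschitz_with_comp. Qed.

Lemma Lip_comp (f : Y -> R) : lip f -> Lip (f \o psi) <= Lip f * L.
Proof.
move=> lf; apply: lip_const_le; apply: lipschitz_with_comp.
exact: lipschitz_with_Lip.
Qed.

Lemma bounded_lip_comp (f : Y -> R) : bounded_lip f -> bounded_lip (f \o psi).
Proof.
move=> [[M fM] lf]; split; last exact: lip_comp.
by exists M => x; exact: fM.
Qed.

(** The source of the factor L^n in all mass estimates: one L for each coordinate function. *)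
Lemma prod_Lip_comp (p : 'I_n -> Y -> R) : (forall i, lip (p i)) ->
  \prod_i Lip (p i \o psi) <= L ^+ n * \prod_i Lip (p i).
Proof.
move=> lp; apply: (@le_trans _ _ (\prod_(i < n) (Lip (p i) * L))).
  by apply: ler_prod => i _; rewrite Lip_ge0/= Lip_comp.
by rewrite big_split/= prodr_const card_ord mulrC.
Qed.

Lemma measurable_omap : measurable_fun setT (omap psi : borel X -> borel Y).
Proof.
apply: measurable_to_borel => // V oV; rewrite setTI.
rewrite (_ : _ @^-1` _ = Some @` (psi @^-1` V)).
  apply: measurable_Some_open; apply: open_comp => // x _.
  exact: lipschitz_with_continuous.
apply/seteqP; split=> [[x|] /= [y Vy]// [yx]|_ [x Vx <-]/=].
  by exists x => //=; rewrite /preimage/= -yx.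
by exists (psi x).
Qed.

Variable T : @functional R X n.

Lemma mass_bound_push (mu : {measure set (borel X) -> \bar R}) : mass_bound T mu ->
  exists2 nu : {measure set (borel Y) -> \bar R}, mass_bound (push_current psi T) nu &
    forall A, (nu A = (L ^+ n)%:E * mu (omap psi @^-1` A))%E.
Proof.
move=> [mu_fin mu0 muT]; have Ln0 : 0 <= L ^+ n by rewrite exprn_ge0.
have [nu [nuE nuI]] := scaled_pushforward mu measurable_omap Ln0.
exists nu => //; split.
- by rewrite nuE preimage_setT lte_mul_pinfty// lee_fin.
- rewrite nuE (_ : _ @^-1` _ = [set None]) ?mu0 ?mule0//.
  by apply/seteqP; split=> -[x|].
- move=> f p bf lp.
  have mf := measurable_ext_norm bf.2.
  have -> : (\int[nu]_o (oapp (fun y => `|f y|) 0 o)%:E =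
      (L ^+ n)%:E * \int[mu]_o (oapp (fun y => `|(f \o psi) y|) 0 o)%:E)%E.
    rewrite (nuI (ext_norm f))//; last by move=> o; exact: ext_norm_ge0.
    by congr (_ * _)%E; apply: eq_integral => -[x|].
  apply: (le_trans (muT _ _ (bounded_lip_comp bf) (fun i => lip_comp (lp i)))).
  rewrite muleA -EFinM; apply: lee_wpmul2r.
    by apply: integral_ge0 => *; exact: ext_norm_ge0.
  by rewrite lee_fin mulrC prod_Lip_comp.
Qed.

Lemma fun_linear_push : fun_linear T -> fun_linear (push_current psi T).
Proof.
move=> lT a f g p bf bg lp; apply: lT; [exact: bounded_lip_comp..|].
by move=> i; exact: lip_comp.
Qed.

End push.

Section current.
Context {R : realType} {X : metricType R} {n : nat}.
Variable T : @functional R X n.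
Hypothesis T_current : is_current T.

(** Linearity with coefficient 1 and both functions zero says that the value is twice itself. *)
Lemma current_coord0 (i : 'I_n) f p : bounded_lip f -> (forall j, lip (p j)) ->
  T f (fun j => if j == i then fun=> 0 else p j) = 0.
Proof.
move=> bf lp.
have := current_linear_coord T_current i 1 bf lp (lip_cst 0) (lip_cst 0).
rewrite [fun x : X => 1 * 0 + 0](_ : _ = fun=> 0); last by apply/funext => x; rewrite mulr0 addr0.
by rewrite mul1r => /eqP; rewrite -subr_eq0 opprD addrA subrr sub0r oppr_eq0 => /eqP.
Qed.

(** Reduces arbitrary Lipschitz constants to 1, as the continuity clause of a current demands. The
    induction is on the number of coordinates already scaled. *)
Lemma current_scale (c : R) f p : bounded_lip f -> (forall j, lip (p j)) ->
  T f (fun j x => c * p j x) = c ^+ n * T f p.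
Proof.
move=> bf lp.
have lcp j : lip (fun x => c * p j x).
  by have := lip_lin c (lp j) (lip_cst 0); congr lip; apply/funext => x; rewrite addr0.
pose q k (j : 'I_n) := if (j < k)%N then fun x => c * p j x else p j.
have lq k j : lip (q k j) by rewrite /q; case: ifP.
have H k : (k <= n)%N -> T f (q k) = c ^+ k * T f p.
  elim: k => [_|k IH kn]; first by rewrite expr0 mul1r.
  rewrite exprS -mulrA -IH; last exact: ltnW.
  have := current_linear_coord T_current (Ordinal kn) c bf (lq k) (lp (Ordinal kn)) (lip_cst 0).
  rewrite current_coord0// addr0 => H; rewrite [LHS](_ : _ = T f (fun j =>
      if j == Ordinal kn then fun x => c * p (Ordinal kn) x + 0 else q k j)).
    rewrite H; congr (c * T f _); apply/funext => j; rewrite /q.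
    by case: eqP => // ->; rewrite /= ltnn.
  congr (T f _); apply/funext => j; rewrite /q ltnS leq_eqVlt.
  case: (eqVneq j (Ordinal kn)) => [->|jk].
    by rewrite eqxx; apply/funext => x; rewrite addr0.
  by rewrite (_ : (val j == k) = false)//; apply/negbTE; apply: contra_neq jk => jk; exact: val_inj.
rewrite -(H n (leqnn n)); congr (T f _); apply/funext => j.
by rewrite /q ltn_ord.
Qed.

Lemma current_fun_linear : fun_linear T.
Proof. by move=> a f g p bf bg lp; exact: current_linear_fun. Qed.

Lemma current_mass_measure : exists mu, is_mass_measure T mu.
Proof.
have [mu Tmu] := current_finite_mass T_current.
exact (exists_mass_measure current_fun_linear Tmu).
Qed.

End current.

Lemma is_current_push (R : realType) (X Y : metricType R) n (psi : X -> Y) (L : R)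
    (T : @functional R X n) : lipschitz_with mdist mdist setT psi L ->
  is_current T -> is_current (push_current psi T).
Proof.
move=> psiL Tc; have L0 : 0 <= L by have [] := psiL.
have blc f := @bounded_lip_comp R X Y psi L psiL f.
have lc f := @lip_comp R X Y psi L psiL f.
split.
- exact (fun_linear_push psiL (current_fun_linear Tc)).
- move=> i a f p g h bf lp lg lh; rewrite /push_current.
  have E (u : Y -> R) : (fun j => (if j == i then u else p j) \o psi) =
      (fun j => if j == i then u \o psi else p j \o psi).
    by apply/funext => j; case: ifP.
  rewrite !E; apply: (current_linear_coord Tc) => //; [exact: blc|..].
  + by move=> j; exact: lc.
  + exact: lc.
  + exact: lc.
- move=> f p bf lp [i [V [c [oV fV pV]]]].
  apply: (current_local Tc); [exact: blc|by move=> j; exact: lc|].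
  exists i, (psi @^-1` V), c; split.
  + by apply: open_comp => // x _; exact: lipschitz_with_continuous psiL _.
  + by move=> x /= fx; exact: fV.
  + by move=> x Vx; exact: pV.
(* Composition with [psi] only yields L-Lipschitz coordinates, so they are divided by c and the
   factor c^n is taken out. L + 1 instead of L keeps c positive. *)
- move=> f p q bf p1 q1 pq; pose c := L + 1.
  have c0 : 0 < c by rewrite ltr_wpDl.
  have sc (u : 'I_n -> Y -> R) : (forall i, lipschitz_with mdist rdist setT (u i) 1) ->
      push_current psi T f u = c ^+ n * T (f \o psi) (fun i x => c^-1 * u i (psi x)).
    move=> u1; rewrite -current_scale//; last 2 first.
    + exact: blc.
    + move=> j; have := lip_lin c^-1 (lc _ (ex_intro _ _ (u1 j))) (lip_cst 0).
      by congr lip; apply/funext => x; rewrite addr0.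
    rewrite /push_current; congr T; apply/funext => j; apply/funext => x /=.
    by rewrite mulrA mulfV ?mul1r// gt_eqF.
  have s1 (u : Y -> R) : lipschitz_with mdist rdist setT u 1 ->
      lipschitz_with mdist rdist setT (fun x => c^-1 * u (psi x)) 1.
    move=> u1; have [_ h] := lipschitz_with_comp psiL u1.
    split => // x y _ _; rewrite /rdist -mulrBr normrM gtr0_norm ?invr_gt0//.
    rewrite ler_pdivrMl// mul1r (le_trans (h x y I I))//.
    by rewrite ler_wpM2r ?mdist_ge0// mul1r lerDl.
  rewrite sc//; under eq_fun do rewrite sc//.
  apply: cvgMr; apply: (current_continuous Tc); [exact: blc|..].
  + by move=> k i; exact: s1.
  + by move=> i; exact: s1.
  + by move=> i x; apply: cvgMr; exact: pq.
- have [mu Tmu] := current_finite_mass Tc.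
  by have [nu ? _] := mass_bound_push psiL Tmu; exists nu.
Qed.

Lemma boundary_push (R : realType) (X Y : metricType R) n (psi : X -> Y)
    (T : @functional R X n.+1) :
  boundary (push_current psi T) = push_current psi (boundary T).
Proof.
apply/funext => f; apply/funext => p; rewrite /boundary /push_current.
by congr T; apply/funext => i; case: (unlift _ _).
Qed.

(** * Lower densities under Lipschitz maps with Lipschitz inverse *)

Section canonical_set.
Context {R : realType}.
Implicit Types X Y : metricType R.

Lemma unit_ball_volume_ge0 n : 0 <= @unit_ball_volume R n.
Proof. by rewrite fine_ge0. Qed.

Lemma lip_mdist X (x : X) : lip (mdist x).
Proof.
exists 1; split=> // u v _ _; rewrite mul1r /rdist ler_norml.
have := metric_triangle x v u; have := metric_triangle x u v.
by rewrite [mdist v u]metric_sym; lra.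
Qed.

(** As [psi] is L-Lipschitz and undoes [phi], the preimage under [phi] of the ball of radius r / L
    at x lies in the ball of radius r at [psi x]. Together with the mass estimate for [phi], the
    mass of S in the latter is at least L^-n times that of the pushforward in the former. *)
Lemma canonical_set_push X Y n (phi : Y -> X) (psi : X -> Y) (L : R)
    (S : @functional R Y n) muS muT :
  0 < L -> lipschitz_with mdist mdist setT phi L ->
  lipschitz_with mdist mdist setT psi L -> cancel phi psi ->
  is_mass_measure S muS -> is_mass_measure (push_current phi S) muT ->
  forall x, canonical_set (push_current phi S) x -> canonical_set S (psi x).
Proof.
move=> L0 phiL psiL phiK SmuS TmuT x.
have mball (Z : metricType R) (z : Z) r : measurable (Some @` ball z r : set (borel Z)).
  apply: measurable_Some_open; rewrite ballEmdist.
  rewrite (_ : mkset _ = (mdist z) @^-1` [set t | t < r]); last by [].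
  apply: open_comp; last exact: open_lt.
  by move=> y _; exact: lip_continuous (lip_mdist z) y.
have [nu Tnu nuE] := mass_bound_push phiL SmuS.1.
have Ln0 : 0 < L ^+ n by rewrite exprn_gt0.
have key r : (((L ^+ n)^-1)%:E * mass_measure (push_current phi S) (ball x (r / L)) <=
    mass_measure S (ball (psi x) r))%E.
  rewrite (mass_measureE TmuT)// (mass_measureE SmuS)//.
  apply: (@le_trans _ _ (((L ^+ n)^-1)%:E * nu (Some @` ball x (r / L)))%E).
    by apply: lee_wpmul2l; [rewrite lee_fin invr_ge0 ltW|exact: TmuT.2].
  rewrite nuE muleA -EFinM mulVf ?gt_eqF// mul1e.
  apply: le_measure; rewrite ?inE//.
    by rewrite -[X in measurable X]setTI; exact: (measurable_omap phiL).
  move=> [y|] /= [z zx]// [zy]; exists y => //.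
  move: zx; rewrite zy !ballEmdist/= ltr_pdivlMr// mulrC; apply: le_lt_trans.
  by rewrite -{1}(phiK y); exact: psiL.2.
rewrite /canonical_set/= => /limf_einf_gt0P[V V0 infV].
apply/limf_einf_gt0P; exists [set r | 0 < r /\ V (r / L)].
  move: V0; rewrite /at_right /within/= => /nbhs_ballP[e /= e0 eV].
  apply/nbhs_ballP; exists (e * L); first exact: mulr_gt0.
  move=> r; rewrite /ball/= sub0r normrN => reL r0; split=> //.
  apply: eV; last by rewrite divr_gt0.
  by rewrite /ball/= sub0r normrN normrM [`|L^-1|]gtr0_norm ?invr_gt0// ltr_pdivrMr.
set c := ereal_inf _ in infV.
(* One factor L^-n comes from the mass estimate, the other from dividing by r^n instead of (r /
   L)^n. *)
apply: (@lt_le_trans _ _ (((L ^+ n)^-1 * (L ^+ n)^-1)%:E * c)%E).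
  by rewrite mule_gt0// lte_fin mulr_gt0 ?invr_gt0.
apply: le_ereal_inf_tmp => _ [r [r0 Vr] <-].
have w0 : 0 <= (unit_ball_volume n * r ^+ n)^-1 :> R.
  by rewrite invr_ge0 mulr_ge0 ?unit_ball_volume_ge0// exprn_ge0// ltW.
apply: (@le_trans _ _ (((L ^+ n)^-1)%:E * mass_measure (push_current phi S) (ball x (r / L)) *
    ((unit_ball_volume n * r ^+ n)^-1)%:E)%E); last first.
  by apply: lee_wpmul2r; rewrite ?lee_fin.
rewrite EFinM -!muleA; apply: lee_wpmul2l; first by rewrite lee_fin invr_ge0 ltW.
have -> : (unit_ball_volume n * r ^+ n)^-1 =
    (L ^+ n)^-1 * (unit_ball_volume n * (r / L) ^+ n)^-1 :> R.
  rewrite -invfM expr_div_n; congr (_^-1).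
  by rewrite [RHS]mulrC -!mulrA mulVf ?mulr1// gt_eqF.
rewrite EFinM muleCA; apply: lee_wpmul2l; first by rewrite lee_fin invr_ge0 ltW.
by apply: ereal_inf_lbound; exists (r / L).
Qed.

End canonical_set.

(** * McShane extensions and the Euclidean distance *)

Section lip_ext.
Context {R : realType} {A : Type} (d : A -> A -> R).
Hypothesis d_ge0 : forall x y, 0 <= d x y.
Hypothesis d_sym : forall x y, d x y = d y x.
Hypothesis d_triangle : forall x y z, d x z <= d x y + d y z.
Hypothesis dxx : forall x, d x x = 0.

(** The formula of [mcshane] for an abstract distance: it is applied to R^n and, for inverses of
    charts, to X. *)
Definition lip_ext (U : set A) (g : A -> R) (x : A) : R :=
  inf [set g u + lip_const d rdist U g * d u x | u in U].

Variables (U : set A) (g : A -> R).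
Hypothesis g_lip : is_lipschitz d rdist U g.

Let K := lip_const d rdist U g.

Let K0 : 0 <= K. Proof. exact: lip_const_ge0. Qed.

Let gK u v : U u -> U v -> g u <= g v + K * d u v.
Proof.
move=> Uu Uv; have [_ /(_ _ _ Uu Uv)] := lipschitz_lip_const d_ge0 g_lip.
rewrite /rdist => /(le_trans (ler_norm _)); rewrite lerBlDr addrC; exact.
Qed.

Let ext_lb x u : U u -> lbound [set g v + K * d v x | v in U] (g u - K * d u x).
Proof.
move=> Uu _ [v Uv <-]; rewrite lerBlDr -addrA -mulrDr.
rewrite (le_trans (gK Uu Uv))// lerD2l ler_wpM2l//.
by rewrite addrC [d v x]d_sym.
Qed.

Let ext_le x u : U u -> lip_ext U g x <= g u + K * d u x.
Proof.
by move=> Uu; apply: ge_inf; [exists (g u - K * d u x); exact: ext_lb|exists u].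
Qed.

Lemma lip_extE x : U x -> lip_ext U g x = g x.
Proof.
move=> Ux; apply/eqP; rewrite eq_le; apply/andP; split.
  by have := @ext_le x _ Ux; rewrite dxx mulr0 addr0.
apply: lb_le_inf; first by exists (g x + K * d x x), x.
by have := @ext_lb x _ Ux; rewrite dxx mulr0 subr0.
Qed.

Lemma lipschitz_lip_ext :
  lipschitz_with d rdist setT (lip_ext U g) (lip_const d rdist U g).
Proof.
split=> // x y _ _; have [->|/set0P[u0 Uu0]] := eqVneq U set0.
  by rewrite /rdist /lip_ext !image_set0 subrr normr0 mulr_ge0// lip_const_ge0.
have H a b : lip_ext U g a <= lip_ext U g b + K * d a b.
  rewrite -lerBlDr; apply: lb_le_inf; first by exists (g u0 + K * d u0 b), u0.
  move=> _ [u Uu <-]; rewrite lerBlDr (le_trans (@ext_le a _ Uu))// -addrA lerD2l.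
  by rewrite -mulrDr ler_wpM2l// [d a b]d_sym.
rewrite /rdist ler_norml; have := H x y; have := H y x.
by rewrite -/K [d y x]d_sym; lra.
Qed.

End lip_ext.

Section edist.
Context {R : realType} {n : nat}.
Implicit Types (x y z v : 'rV[R]_n).

Lemma edist_ge0 x y : 0 <= edist x y. Proof. exact: sqrtr_ge0. Qed.

Lemma edist_sym x y : edist x y = edist y x.
Proof. by congr Num.sqrt; apply: eq_bigr => j _; rewrite -opprB sqrrN. Qed.

Lemma edistxx x : edist x x = 0.
Proof. by rewrite /edist big1 ?sqrtr0// => j _; rewrite subrr expr0n. Qed.

Lemma sum_sqr_ge0 (a : 'I_n -> R) : 0 <= \sum_j a j ^+ 2.
Proof. by apply: sumr_ge0 => j _; exact: sqr_ge0. Qed.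

(** Cauchy-Schwarz. For nonzero norms A and B, the difference of the two sides is the sum of the
    squares (B a_j - A b_j)^2 divided by 2 A B. *)
Lemma sum_mul_le_sqrt (a b : 'I_n -> R) :
  \sum_j a j * b j <= Num.sqrt (\sum_j a j ^+ 2) * Num.sqrt (\sum_j b j ^+ 2).
Proof.
set A := Num.sqrt _; set B := Num.sqrt _.
have null (c : 'I_n -> R) : Num.sqrt (\sum_j c j ^+ 2) = 0 -> forall j, c j = 0.
  move=> /eqP; rewrite sqrtr_eq0 => c0 j; apply/eqP; rewrite -sqrf_eq0.
  have : \sum_j c j ^+ 2 == 0 by rewrite eq_le c0 sum_sqr_ge0.
  rewrite psumr_eq0; last by move=> i _; exact: sqr_ge0.
  by move=> /allP/(_ j (mem_index_enum _)).
have [A0|A0] := eqVneq A 0.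
  by rewrite A0 mul0r big1// => j _; rewrite (null _ A0) mul0r.
have [B0|B0] := eqVneq B 0.
  by rewrite B0 mulr0 big1// => j _; rewrite (null _ B0) mulr0.
have Ap : 0 < A by rewrite lt_neqAle eq_sym A0 sqrtr_ge0.
have Bp : 0 < B by rewrite lt_neqAle eq_sym B0 sqrtr_ge0.
have -> : A * B = \sum_j ((B / A) * a j ^+ 2 + (A / B) * b j ^+ 2) / 2.
  rewrite -mulr_suml big_split/= -!mulr_sumr.
  rewrite -[\sum_j a j ^+ 2]sqr_sqrtr ?sum_sqr_ge0// -[\sum_j b j ^+ 2]sqr_sqrtr ?sum_sqr_ge0//.
  by rewrite -/A -/B; field; rewrite A0 B0.
apply: ler_sum => j _; rewrite -subr_ge0.
have -> : (B / A * a j ^+ 2 + A / B * b j ^+ 2) / 2 - a j * b j =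
  (B * a j - A * b j) ^+ 2 / (2 * A * B) by field; rewrite A0 B0.
by rewrite divr_ge0 ?sqr_ge0// !mulr_ge0// ltW.
Qed.

Lemma edist_triangle x y z : edist x z <= edist x y + edist y z.
Proof.
rewrite -[leRHS]ger0_norm ?addr_ge0 ?edist_ge0// -sqrtr_sqr ler_wsqrtr//.
rewrite sqrrD /edist !sqr_sqrtr ?sum_sqr_ge0//.
have := sum_mul_le_sqrt (fun j => x 0 j - y 0 j) (fun j => y 0 j - z 0 j).
set P := Num.sqrt _ * _ => H.
apply: (@le_trans _ _ (\sum_j (x 0 j - y 0 j) ^+ 2 +
    (\sum_j (x 0 j - y 0 j) * (y 0 j - z 0 j)) *+ 2 + \sum_j (y 0 j - z 0 j) ^+ 2)).
  rewrite -mulr_natl mulr_sumr -!big_split/= le_eqVlt; apply/orP; left; apply/eqP.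
  by apply: eq_bigr => j _; ring.
by rewrite lerD2r lerD2l ler_pMn2r.
Qed.

Lemma edist_coord x y j : `|x 0 j - y 0 j| <= edist x y.
Proof.
rewrite -sqrtr_sqr ler_wsqrtr// (bigD1 j)//= lerDl.
by apply: sumr_ge0 => i _; exact: sqr_ge0.
Qed.

Lemma edist_le x y (M : R) : 0 <= M -> (forall j, `|x 0 j - y 0 j| <= M) ->
  edist x y <= Num.sqrt n%:R * M.
Proof.
move=> M0 H; rewrite -[X in _ * X](ger0_norm M0) -sqrtr_sqr -sqrtrM ?ler0n//.
rewrite ler_wsqrtr//; apply: (@le_trans _ _ (\sum_(j < n) M ^+ 2)).
  by apply: ler_sum => j _; rewrite -real_normK ?num_real// lerXn2r ?nnegrE.
by rewrite sumr_const card_ord mulr_natl.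
Qed.

Lemma edist_shift (h : R) v x : edist (h *: v + x) x = `|h| * edist v 0.
Proof.
rewrite /edist -sqrtr_sqr -sqrtrM ?sqr_ge0//; congr Num.sqrt.
by rewrite mulr_sumr; apply: eq_bigr => j _; rewrite !mxE; ring.
Qed.

Lemma edist_delta (j : 'I_n) : edist (delta_mx 0 j : 'rV[R]_n) 0 = 1.
Proof.
rewrite /edist (bigD1 j)//= big1 ?addr0.
  by rewrite !mxE !eqxx subr0 expr1n sqrtr1.
by move=> i ij; rewrite !mxE (negbTE ij) subr0 expr0n.
Qed.

Lemma lipschitz_edist_continuous (f : 'rV[R]_n -> R) K :
  lipschitz_with edist rdist setT f K -> continuous f.
Proof.
move=> [K0 fK] x; apply/(@cvgrPdist_lt _ _ _ (nbhs x) (nbhs_filter x)) => /= e e0.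
pose C := K * Num.sqrt n%:R + 1.
have C0 : 0 < C by rewrite ltr_wpDl// mulr_ge0// sqrtr_ge0.
near=> y; rewrite (le_lt_trans (fK x y I I))//.
have yx j : `|x 0 j - y 0 j| <= e / C.
  have [_ h] : ball x (e / C) y.
    by near: y; apply: nbhsx_ballx; rewrite divr_gt0.
  by have := h 0 j; rewrite /ball/= => /ltW.
have eC0 : 0 < e / C by rewrite divr_gt0.
apply: (@le_lt_trans _ _ (K * (Num.sqrt n%:R * (e / C)))).
  by rewrite ler_wpM2l// edist_le// ltW.
rewrite mulrA -[ltRHS](@divfK _ C) ?gt_eqF// mulrC ltr_pM2l//.
by rewrite ltrDl.
Unshelve. all: by end_near. Qed.

Lemma mcshaneE (U : set 'rV[R]_n) g x : is_lipschitz edist rdist U g -> U x ->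
  mcshane U g x = g x.
Proof.
move=> gl Ux; apply: (@lip_extE _ _ edist) => //.
- exact: edist_ge0.
- exact: edist_sym.
- exact: edist_triangle.
- exact: edistxx.
Qed.

Lemma lipschitz_mcshane (U : set 'rV[R]_n) g : is_lipschitz edist rdist U g ->
  lipschitz_with edist rdist setT (mcshane U g) (lip_const edist rdist U g).
Proof.
move=> gl; apply: (@lipschitz_lip_ext _ _ edist) => //.
- exact: edist_ge0.
- exact: edist_sym.
- exact: edist_triangle.
Qed.

Lemma measurable_borel_rV (f : 'rV[R]_n -> R) : continuous f ->
  measurable_fun setT (f : borel_rV n -> measurableTypeR R).
Proof.
move=> cf; apply: (measurability _ (RGenOpens.measurableE R)).
move=> _ [_ [a [b ->] <-]]; rewrite setTI; apply: sub_sigma_algebra => /=.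
by apply: open_comp => //; exact: interval_open.
Qed.

Lemma measurable_closed_rV (A : set 'rV[R]_n) : closed A -> measurable (A : set (borel_rV n)).
Proof.
move=> cA; rewrite -(setCK A); apply: measurableC; apply: sub_sigma_algebra.
exact: closed_openC.
Qed.

End edist.

(** * Directional derivatives of Lipschitz functions *)

Section derive_measurable.
Context {R : realType} {n : nat}.
Variables (g : 'rV[R]_n -> R) (K : R) (v : 'rV[R]_n).
Hypothesis gK : lipschitz_with edist rdist setT g K.

Let q (h : R) (x : 'rV[R]_n) : R := h^-1 * (g (h *: v + x) - g x).

Let deriveE x : 'D_v g x = lim (q h x @[h --> 0^']).
Proof. by []. Qed.

Let q_continuous h : continuous (q h).
Proof.
apply: (@lipschitz_edist_continuous _ _ _ (`|h^-1| * (K + K))); split.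
  by rewrite mulr_ge0// addr_ge0//; case: gK.
move=> x y _ _; rewrite /rdist /q -mulrBr normrM -mulrA ler_wpM2l//.
rewrite opprD addrACA -opprD mulrDl (le_trans (ler_normB _ _))//.
rewrite lerD//; last exact: gK.2.
apply: le_trans (gK.2 _ _ I I) _; rewrite ler_wpM2l ?(proj1 gK)//.
rewrite /edist ler_wsqrtr//; apply: ler_sum => j _; rewrite !mxE.
by rewrite le_eqVlt; apply/orP; left; apply/eqP; ring.
Qed.

Let q_bound h x : h != 0 -> `|q h x| <= K * edist v 0.
Proof.
move=> h0; rewrite /q normrM normrV ?unitfE// ler_pdivrMl ?normr_gt0//.
apply: le_trans (gK.2 _ _ I I) _.
by rewrite edist_shift mulrCA.
Qed.

(** The Cauchy condition on the difference quotients, tolerance 1/(k+1) at scale 1/(m+1). Ranging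
    over all real increments is harmless: an arbitrary intersection of closed sets is closed. *)
Let A (k m : nat) : set 'rV[R]_n := \bigcap_(h in [set h : R * R |
    [/\ h.1 != 0, h.2 != 0, `|h.1| < m.+1%:R^-1 & `|h.2| < m.+1%:R^-1]])
  [set x | `|q h.1 x - q h.2 x| <= k.+1%:R^-1].

Let A_closed k m : closed (A k m).
Proof.
apply: closed_bigI => -[h h'] _ /=.
rewrite (_ : mkset _ = (fun x => `|q h x - q h' x|) @^-1` [set t | t <= k.+1%:R^-1]); last by [].
apply: closed_comp; last exact: closed_le.
move=> x _; apply: (@cvg_norm _ _ _ _ (nbhs_filter x)).
by apply: cvgB; exact: q_continuous.
Qed.

Let inv_lt (e : R) : 0 < e -> exists m : nat, m.+1%:R^-1 < e.
Proof.
move=> e0; exists (Num.truncn e^-1).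
by rewrite invf_plt ?posrE//; exact: truncnS_gt.
Qed.

Let cvgqP x : cvg (q h x @[h --> 0^']) <-> (\bigcap_k \bigcup_m A k m) x.
Proof.
split=> [/cvg_ex[l /cvgrPdist_lt ql] k _|Ax].
  have k0 : 0 < k.+1%:R^-1 / 2 :> R by rewrite divr_gt0// invr_gt0.
  have [d /= d0 dql] := ql _ k0.
  have [m md] := inv_lt d0; exists m => // -[h h'] [/= h0 h0' hm hm'].
  have H (t : R) : t != 0 -> `|t| < m.+1%:R^-1 -> `|l - q t x| < k.+1%:R^-1 / 2.
    by move=> t0 tm; apply: dql => //=; rewrite sub0r normrN (lt_trans tm).
  rewrite -(subrKA l) [X in _ <= X]splitr (le_trans (ler_normD _ _))// lerD ?ltW ?H//.
  by rewrite distrC H.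
apply: cauchy_cvg; apply/cauchyP => e e0.
have [k ke] := inv_lt e0; have [m _ Am] := Ax k I.
have m0 : 0 < m.+1%:R^-1 :> R by rewrite invr_gt0.
exists (q (m.+1%:R^-1 / 2) x).
apply/nbhs_ballP; exists m.+1%:R^-1 => //= h; rewrite /ball/= sub0r normrN => hm h0.
rewrite (le_lt_trans _ ke)//; apply: (Am (m.+1%:R^-1 / 2, h)); split => /=.
- by rewrite mulf_neq0// invr_eq0 pnatr_eq0.
- exact: h0.
- by rewrite gtr0_norm ?divr_gt0// ltr_pdivrMr// ltr_pMr// ltr1n.
- exact: hm.
Qed.

Let C := \bigcap_k \bigcup_m A k m.

(** On the Borel set C of convergence the derivative is the limit of continuous quotients along h =
    1/(m+1); off C it is the constant default value of a divergent limit. *)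
Lemma measurable_derive :
  measurable_fun setT (fun x : borel_rV n => 'D_v g x : measurableTypeR R).
Proof.
have mA k m : measurable (A k m : set (borel_rV n)) by exact: measurable_closed_rV.
have mC : measurable (C : set (borel_rV n)).
  by apply: bigcap_measurable => // k _; exact: bigcup_measurable.
rewrite -(setUv C); apply/measurable_funU => //; first exact: measurableC.
split.
- apply: (@measurable_fun_cvg _ (borel_rV n) R C (fun m => q m.+1%:R^-1)).
    by move=> m; apply: measurable_funTS; apply: measurable_borel_rV.
  move=> x /cvgqP; rewrite /cvgP => qx.
  have : (m.+1%:R^-1 : R) @[m --> \oo] --> (0 : R)^'.
    move=> P [d /= d0 dP]; have [m0 m0d] := inv_lt d0.
    exists m0 => // m /= m0m; apply: dP; last by rewrite invr_eq0 pnatr_eq0.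
    rewrite /= sub0r normrN gtr0_norm ?invr_gt0// (le_lt_trans _ m0d)//.
    by rewrite lef_pV2 ?posrE// ler_nat.
  by move=> h; apply: (cvg_comp _ _ h qx).
- apply: (eq_measurable_fun (fun=> point)); last exact: measurable_cst.
  move=> x; rewrite inE => Cx; rewrite deriveE dvgP// => /cvgqP.
  exact: Cx.
Qed.

(** True at every x, since the default value of a missing derivative is 0. *)
Lemma derive_le x : `|'D_v g x| <= K * edist v 0.
Proof.
have [/cvg_norm cq|dq] := pselect (cvg (q h x @[h --> 0^'])); last first.
  rewrite deriveE dvgP// (_ : point = 0 :> R)// normr0 mulr_ge0 ?edist_ge0//.
  exact: gK.1.
rewrite deriveE -(cvg_lim _ cq)//; apply: limr_le.
  by apply/cvg_ex; eexists; exact: cq.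
near=> h; apply: q_bound; near: h.
exact: nbhs_dnbhs_neq.
Unshelve. all: by end_near. Qed.

End derive_measurable.

(** * Charts *)

(** The layer decomposition of an integer, used with N = |theta(x)|: N counts the k below it. *)
Lemma nneseries_count (R : realType) (N : nat) (c : R) : 0 <= c ->
  (\sum_(k <oo) ((k < N)%N%:R * c)%:E = (N%:R * c)%:E)%E.
Proof.
move=> c0; have t0 k : (0 <= ((k < N)%N%:R * c)%:E)%E by rewrite lee_fin mulr_ge0.
rewrite (nneseries_split 0 N)//= add0n eseries0 ?adde0; last first.
  by move=> k /= Nk _; rewrite ltnNge Nk mul0r.
rewrite big_mkord (eq_bigr (fun=> c%:E)); last by move=> k _; rewrite ltn_ord mul1r.
by rewrite sumEFin sumr_const card_ord mulr_natl.
Qed.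

Section integer_density.
Context d (T : measurableType d) (R : realType).
Variables (mu : {measure set T -> \bar R}) (U : set T) (theta : T -> int).
Hypothesis mU : measurable U.
Hypothesis theta_int : mu.-integrable U (fun x => ((theta x)%:~R : R)%:E).

Let abs_theta (x : T) : R := `|(theta x)%:~R|.

Let abs_thetaE x : abs_theta x = `|theta x|%N%:R.
Proof. by rewrite /abs_theta -intr_norm -natr_absz. Qed.

Let mabs_theta : measurable_fun U abs_theta.
Proof.
apply: measurableT_comp => //.
by have /integrableP[/measurable_EFinP] := theta_int.
Qed.

Let V k := U `&` abs_theta @^-1` `]k%:R, +oo[%classic.

Let mV k : measurable (V k). Proof. exact: mabs_theta. Qed.

Let indicV k x : U x -> \1_(V k) x = (k < `|theta x|)%N%:R :> R.
Proof.
move=> Ux; rewrite indicE; congr (_%:R); congr nat_of_bool.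
apply/idP/idP; rewrite inE /V /= in_itv/= andbT abs_thetaE ltr_nat; first by case.
by move=> ?; split.
Qed.

Let integral_layers (g : T -> R) : measurable_fun setT g -> (forall x, 0 <= g x) ->
  (\int[mu]_(x in U) (abs_theta x * g x)%:E = \sum_(k <oo) \int[mu]_(x in V k) (g x)%:E)%E.
Proof.
move=> mg g0.
transitivity (\int[mu]_(x in U) \sum_(k <oo) (\1_(V k) x * g x)%:E)%E.
  apply: eq_integral => x; rewrite inE => Ux.
  rewrite abs_thetaE -nneseries_count//; apply: eq_eseriesr => k _.
  by rewrite indicV.
rewrite integral_nneseries//; first last.
- by move=> k x _; rewrite lee_fin mulr_ge0.
- move=> k; apply/measurable_EFinP; apply: measurable_funM.
    by apply: measurable_funTS; exact: measurable_indic.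
  exact: measurable_funTS.
apply: eq_eseriesr => k _; rewrite integral_mkcond [RHS]integral_mkcond.
apply: eq_integral => x _; rewrite !patchE indicE.
case: (boolP (x \in V k)) => [xV|xV]; last by rewrite mul0r if_same.
by rewrite mul1r; move: xV; rewrite inE => -[Ux _]; rewrite mem_set.
Qed.

(* |theta| mu is the sum of the restrictions of mu to the sets {|theta| > k}. *)
Lemma integer_density : exists w : {measure set T -> \bar R},
  [/\ (w setT < +oo)%E, w (~` U) = 0%E &
    forall g : T -> R, measurable_fun setT g -> (forall x, 0 <= g x) ->
      (\int[mu]_(x in U) (`|(theta x)%:~R| * g x)%:E <= \int[w]_x (g x)%:E)%E].
Proof.
exists (mseries (fun k => mrestr mu (mV k)) 0); split.
- rewrite /= /mseries.
  have -> : (\sum_(k <oo) mrestr mu (mV k) setT =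
      \int[mu]_(x in U) (abs_theta x * 1)%:E)%E.
    rewrite (integral_layers (g := fun=> 1))//; apply: eq_eseriesr => k _.
    by rewrite integral_cst// mul1e /mrestr setTI.
  have /integrableP[_] := theta_int.
  by congr (_ < _)%E; apply: eq_integral => x _; rewrite mulr1.
- rewrite /= /mseries; apply: eseries0 => k _ _.
  rewrite /= /mrestr (_ : ~` U `&` V k = set0) ?measure0//.
  by apply/seteqP; split=> // x [Ux [/Ux]].
- move=> g mg g0; rewrite integral_layers// ge0_integral_measure_series//.
  + apply: lee_nneseries.
      by move=> k _ _; apply: integral_ge0 => x _; rewrite lee_fin.
    move=> k _.
    have -> : (\int[mu]_(x in V k) (g x)%:E =
        \int[mrestr mu (mV k)]_(x in V k) (g x)%:E)%E.
      by apply: eq_measure_integral => A mA AV; rewrite /= /mrestr (setIidl AV).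
    apply: ge0_subset_integral => //; first exact/measurable_EFinP.
    by move=> x _; rewrite lee_fin.
  + by move=> x _; rewrite lee_fin.
  + exact/measurable_EFinP.
Qed.

End integer_density.

Section chart.
Context {R : realType} {X : metricType R} {n : nat}.
Variables (U : set 'rV[R]_n) (phi : 'rV[R]_n -> X) (L : R).
Hypothesis mU : measurable (U : set (borel_rV n)).
Hypothesis L0 : 0 < L.
Hypothesis phiL : forall x y, U x -> U y ->
  edist x y / L <= mdist (phi x) (phi y) <= L * edist x y.

Lemma lipschitz_chart (f : X -> R) : lip f ->
  lipschitz_with edist rdist U (f \o phi) (Lip f * L).
Proof.
move=> lf; have [_ h] := lipschitz_with_Lip lf.
split=> [|x y Ux Uy]; first by rewrite mulr_ge0 ?Lip_ge0// ltW.
rewrite (le_trans (h _ _ I I))// -mulrA ler_wpM2l ?Lip_ge0//.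
by have /andP[] := phiL Ux Uy.
Qed.

Lemma mcshane_chart_continuous (f : X -> R) : lip f -> continuous (mcshane U (f \o phi)).
Proof.
move=> lf; apply: lipschitz_edist_continuous; apply: lipschitz_mcshane.
by exists (Lip f * L); exact: lipschitz_chart.
Qed.

Lemma mcshane_chartE (f : X -> R) x : lip f -> U x -> mcshane U (f \o phi) x = f (phi x).
Proof.
move=> lf Ux; rewrite mcshaneE//.
by exists (Lip f * L); exact: lipschitz_chart.
Qed.

(** [phi] is controlled on U only. Sending the rest to the additional point gives a total Borel map,
    along which measures can be pushed. *)
Definition chart_point (x : borel_rV n) : borel X := if x \in U then Some (phi x) else None.

Lemma open_bump_gt0 (V : set X) x : open V -> V x -> 0 < open_bump V 1 x.
Proof.
move=> oV Vx; have /nbhs_ballP[r /= r0 xrV] : nbhs x V by exact: open_nbhs_nbhs.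
apply: (@lt_le_trans _ _ (Num.min 1 r)); first by rewrite lt_min ltr01.
apply: lb_le_inf; first by exists 1; left.
move=> _ [->|[y Vy <-]]; first by rewrite ge_min lexx.
rewrite mul1r ge_min; apply/orP; right; rewrite leNgt; apply/negP => xyr.
by apply: Vy; apply: xrV; rewrite ballEmdist.
Qed.

(** An open V is the positivity set of a Lipschitz bump, so its preimage is the part of U where the
    McShane extension of the pulled back bump, a continuous function on R^n, is positive. *)
Lemma measurable_chart_point : measurable_fun setT chart_point.
Proof.
apply: measurable_to_borel => // V oV; rewrite setTI.
rewrite (_ : _ @^-1` _ =
    (U : set (borel_rV n)) `&` (mcshane U (open_bump V 1 \o phi) @^-1` `]0, +oo[%classic)).
  apply: measurableI => //; rewrite -[X in measurable X]setTI.
  apply: measurable_borel_rV => //; apply: mcshane_chart_continuous.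
  exact: lip_open_bump.
have lb := @lip_open_bump R X V 1 ler01.
apply/seteqP; split=> [x|x [Ux]] /=; rewrite /chart_point /=.
  case: ifPn => [|_ []//]; rewrite inE => Ux [y Vy [yx]].
  split=> //; rewrite in_itv/= andbT mcshane_chartE//.
  by apply: open_bump_gt0 => //; rewrite -yx.
rewrite in_itv/= andbT mcshane_chartE// mem_set// => h; exists (phi x) => //.
by apply: contrapT => Vx; move: h; rewrite open_bump_eq0 ?ltxx.
Qed.

(** The coordinates of the inverse of [phi] are Lipschitz on the image E and extend to a Borel map G
    from X to R^n. Then E is the intersection of its closure with the preimage of U under G: on the
    closure, [phi] after G is the identity wherever G lands in U. *)
Lemma measurable_chart_image : measurable (Some @` (phi @` U) : set (borel X)).
Proof.
have dge0 := @mdist_ge0 R X; have dsym := @metric_sym R X.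
have dtri := @metric_triangle R X; have dxx := @mdistxx R X.
set E := phi @` U.
have /choice[psi psiP] : forall y, exists u, E y -> U u /\ phi u = y.
  move=> y; have [[u Uu uy]|Ey] := pselect (E y); first by exists u.
  by exists 0 => /Ey.
have psiL j : lipschitz_with mdist rdist E (fun y => psi y 0 j) L.
  split=> [|y z Ey Ez]; first exact: ltW.
  have [Uy phiy] := psiP _ Ey; have [Uz phiz] := psiP _ Ez.
  rewrite (le_trans (edist_coord _ _ _))//.
  have /andP[h _] := phiL Uy Uz; move: h.
  by rewrite phiy phiz ler_pdivrMr// mulrC.
pose g j := lip_ext mdist E (fun y => psi y 0 j).
have gL j : lipschitz_with mdist rdist setT (g j) L.
  apply: (@lipschitz_withW _ _ _ _ dge0 _ (lip_const mdist rdist E (fun y => psi y 0 j))).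
    by apply: lip_const_le; exact: psiL.
  by apply: lipschitz_lip_ext => //; exists L; exact: psiL.
have gE j y : E y -> g j y = psi y 0 j.
  by move=> Ey; apply: lip_extE => //; exists L; exact: psiL.
pose G (o : borel X) : borel_rV n := \row_j oapp (g j) 0 o.
have mG : measurable_fun setT G.
  apply: measurable_rV => j.
  apply: (eq_measurable_fun (fun o : borel X => oapp (g j) 0 o)).
    by move=> o _; rewrite mxE.
  by apply: measurable_oapp; apply: lip_continuous; exists L.
rewrite (_ : Some @` E = (Some @` (closure E)) `&` G @^-1` U).
  apply: measurableI; last by rewrite -[X in measurable X]setTI; exact: mG.
  rewrite (_ : Some @` _ = Some @` setT `\` Some @` (~` closure E)).
    apply: measurableD; apply: measurable_Some_open; first exact: openT.
    by apply: closed_openC; exact: closed_closure.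
  apply/seteqP; split=> [_ [y Ey <-]|_ [[y _ <-] h]].
    by split; [exists y|move=> [z Ez [zy]]; apply: Ez; rewrite zy].
  by exists y => //; apply: contrapT => Ey; apply: h; exists y.
apply/seteqP; split=> [_ [y Ey <-]|_ [[y Ey <-]]].
  split; first by exists y => //; exact: subset_closure.
  have [Uy _] := psiP _ Ey.
  rewrite /preimage/= (_ : G _ = psi y)//; apply/rowP => j.
  by rewrite mxE/= gE.
rewrite /preimage/=; set u := G (Some y) => Uu; exists y => //; exists u => //.
apply: mdist_positivity; apply/eqP; rewrite eq_le mdist_ge0 andbT.
(* y is approximated by points phi v = z with v = G z, and G is continuous. *)
apply/ler_addgt0Pl => e e0; rewrite addr0.
(* G has Euclidean Lipschitz constant sqrt(n) L, as its n coordinates are L-Lipschitz; [phi]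
   contributes another L, and the 1 accounts for the distance from z to y. *)
pose C := L * (Num.sqrt n%:R * L) + 1.
have C0 : 0 < C by rewrite ltr_wpDl// !mulr_ge0 ?sqrtr_ge0// ltW.
have d0 : 0 < e / C by rewrite divr_gt0.
have [z [Ez yz]] := Ey _ (@nbhsx_ballx _ X y _ d0).
move: yz; rewrite ballEmdist/= => yz.
have [Uz phiz] := psiP _ Ez.
rewrite (le_trans (metric_triangle _ z _))//.
have uz : edist u (psi z) <= Num.sqrt n%:R * (L * mdist y z).
  apply: edist_le => [|j]; first by rewrite mulr_ge0 ?mdist_ge0// ltW.
  by rewrite /u mxE/= -gE//; exact: (gL j).2.
apply: (@le_trans _ _ (C * mdist y z)); last first.
  by rewrite mulrC -ler_pdivlMr// ltW.
rewrite mulrDl mul1r lerD//; last by rewrite metric_sym.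
have /andP[_ h] := phiL Uu Uz; rewrite -[X in mdist _ X]phiz (le_trans h)//.
by rewrite -!mulrA ler_wpM2l// ltW.
Qed.

Definition chart_jacobian (p : 'I_n -> X -> R) (x : 'rV[R]_n) : R :=
  \det (\matrix_(i, j) 'D_(delta_mx 0 j) (mcshane U (p i \o phi)) x).

Lemma measurable_chart_jacobian p : (forall i, lip (p i)) ->
  measurable_fun setT (chart_jacobian p : borel_rV n -> measurableTypeR R).
Proof.
move=> lp; rewrite /chart_jacobian /determinant.
apply: measurable_sum => s; apply: measurable_funM; first exact: measurable_cst.
apply: measurable_prod => i _.
under eq_fun do rewrite mxE.
apply: measurable_derive; apply: lipschitz_mcshane.
by exists (Lip (p i) * L); exact: lipschitz_chart.
Qed.

(** The determinant has n! terms, each a product of n partial derivatives bounded by L [Lip (p i)],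
    since the McShane extension keeps the Lipschitz constant. *)
Lemma chart_jacobian_le p x : (forall i, lip (p i)) ->
  `|chart_jacobian p x| <= n`!%:R * L ^+ n * \prod_i Lip (p i).
Proof.
move=> lp; rewrite /chart_jacobian /determinant.
apply: le_trans (ler_norm_sum _ _ _) _.
apply: (@le_trans _ _ (\sum_(s : {perm 'I_n}) (L ^+ n * \prod_i Lip (p i)))).
  apply: ler_sum => s _; rewrite normrM normrX normrN1 expr1n mul1r normr_prod.
  apply: (@le_trans _ _ (\prod_(i < n) (L * Lip (p i)))).
    apply: ler_prod => i _; rewrite normr_ge0/= mxE.
    have lpi : is_lipschitz edist rdist U (p i \o phi).
      by exists (Lip (p i) * L); exact: lipschitz_chart.
    apply: le_trans (derive_le _ (lipschitz_mcshane lpi) _) _.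
    rewrite edist_delta mulr1 mulrC; apply: lip_const_le; exact: lipschitz_chart.
  by rewrite big_split/= prodr_const card_ord.
by rewrite -mulrA mulr_natl sumr_const card_Sn.
Qed.

Variable theta : 'rV[R]_n -> int.
Hypothesis theta_int : (lebesgue n).-integrable U (fun x => ((theta x)%:~R : R)%:E).

Let c := Chart U theta phi.

Let integrand (f : X -> R) p (x : 'rV[R]_n) : R :=
  (theta x)%:~R * f (phi x) * chart_jacobian p x.

Let m_integrand f p : bounded_lip f -> (forall i, lip (p i)) ->
  measurable_fun (U : set (borel_rV n)) (fun x => integrand f p x : measurableTypeR R).
Proof.
move=> bf lp; apply: measurable_funM; last first.
  by apply: measurable_funTS; exact: measurable_chart_jacobian.
apply: measurable_funM.
  by have /integrableP[/measurable_EFinP] := theta_int.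
apply: (@eq_measurable_fun _ _ (borel_rV n) _ U (mcshane U (f \o phi))).
  by move=> x; rewrite inE => Ux; rewrite mcshane_chartE//; exact: bf.2.
apply: measurable_funTS; apply: measurable_borel_rV.
by apply: mcshane_chart_continuous; exact: bf.2.
Qed.

Let integrable_integrand f p : bounded_lip f -> (forall i, lip (p i)) ->
  (lebesgue n).-integrable U (fun x => (integrand f p x)%:E).
Proof.
move=> bf lp; have [[M fM] lf] := bf.
pose C := n`!%:R * L ^+ n * \prod_i Lip (p i).
have := integrableZl mU (M * C) theta_int.
apply: le_integrable => //.
  by apply/measurable_EFinP; exact: m_integrand.
move=> x Ux; rewrite /= lee_fin /integrand -mulrA !normrM mulrC ler_wpM2r//.
rewrite ler_pM//; first by rewrite (le_trans (fM _))// ler_norm.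
by rewrite -!normrM (le_trans (chart_jacobian_le _ lp))// ler_norm.
Qed.

Lemma fun_linear_chart : fun_linear (chart_current c).
Proof.
move=> a f g p bf bg lp; rewrite /chart_current /push_current /int_current /=.
transitivity (\int[lebesgue n]_(x in U) (a * integrand f p x + integrand g p x)).
  by apply: eq_Rintegral => x _; rewrite /integrand /chart_jacobian; ring.
rewrite RintegralD//.
- by rewrite RintegralZl//; exact: integrable_integrand.
- have := integrableZl mU a (integrable_integrand bf lp).
  by apply: eq_integrable.
- exact: integrable_integrand.
Qed.

(** The bound is n! L^n times the image under [chart_point] of the measure with density |theta| on
    U. *)
Lemma mass_bound_chart : exists2 m : {measure set (borel X) -> \bar R},
  mass_bound (chart_current c) m & m (~` (Some @` chart_image c)) = 0%E.
Proof.
have [w [w_fin wU wI]] := integer_density mU theta_int.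
pose C := n`!%:R * L ^+ n.
have C0 : 0 <= C by rewrite mulr_ge0// exprn_ge0// ltW.
have [m [mE mI]] := scaled_pushforward w measurable_chart_point C0.
(* Such a set pulls back to the complement of U, which is null for [w]. It is used both for the
   additional point and for the complement of the chart image. *)
have pre0 (A : set (borel X)) : A None -> (forall x, U x -> ~ A (Some (phi x))) ->
    chart_point @^-1` A = ~` U.
  move=> AN AS; apply/seteqP; split=> x; rewrite /preimage/= /chart_point.
    by move=> + Ux; rewrite mem_set//; exact: AS.
  by move=> Ux; rewrite memNset.
exists m.
  split.
  - by rewrite mE preimage_setT lte_mul_pinfty// lee_fin.
  - by rewrite mE pre0 ?wU ?mule0.
  - move=> f p bf lp; have mf := measurable_ext_norm bf.2.
    pose g x := oapp (fun y => `|f y|) 0 (chart_point x).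
    have mg : measurable_fun setT (g : borel_rV n -> measurableTypeR R).
      have := measurableT_comp mf measurable_chart_point.
      by move/measurable_EFinP.
    have g0 x : 0 <= g x by rewrite /g; case: chart_point => /=.
    set P := \prod_i _; have P0 : 0 <= P by exact: prod_Lip_ge0.
    have gU x : U x -> g x = `|f (phi x)|.
      by move=> Ux; rewrite /g /chart_point mem_set.
    rewrite (mI (ext_norm f))//; last by move=> o; exact: ext_norm_ge0.
    apply: (@le_trans _ _ (`|\int[lebesgue n]_(x in U) (integrand f p x)%:E|)%E).
      rewrite -[X in (_ <= `|X|)%E]fineK; last first.
        exact: integrable_fin_num (integrable_integrand bf lp).
      by rewrite lexx.
    apply: le_trans (le_abse_integral _ mU _) _.
      by apply/measurable_EFinP; exact: m_integrand.
    apply: (@le_trans _ _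
        (\int[lebesgue n]_(x in U) ((P * C)%:E * (`|(theta x)%:~R| * g x)%:E))%E).
      apply: ge0_le_integral => //.
      + apply: measurableT_comp => //.
        by apply/measurable_EFinP; exact: m_integrand.
      + apply: measurable_funeM; apply/measurable_EFinP; apply: measurable_funM.
          apply: measurableT_comp => //.
          by have /integrableP[/measurable_EFinP] := theta_int.
        exact: measurable_funTS.
      + move=> x Ux; rewrite /= lee_fin gU// /integrand !normrM mulrC ler_wpM2r//.
        by rewrite (le_trans (chart_jacobian_le _ lp))// mulrC.
    rewrite ge0_integralZl_EFin//; first last.
    + by rewrite mulr_ge0.
    + apply/measurable_EFinP; apply: measurable_funM; last exact: measurable_funTS.
      apply: measurableT_comp => //.
      by have /integrableP[/measurable_EFinP] := theta_int.
    + by move=> x _; rewrite lee_fin mulr_ge0.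
    rewrite EFinM -muleA lee_wpmul2l ?lee_fin// lee_wpmul2l ?lee_fin//.
    exact: wI.
rewrite mE pre0 ?wU ?mule0//; first by case.
by move=> x Ux; apply; exists (phi x) => //; exists x.
Qed.

End chart.

(** * Completions *)

Section completion.
Context {R : realType} {X Xb : metricType R}.
Variable i : X -> Xb.
Hypothesis iX : is_completion i.

Lemma completion_dense (x : Xb) (e : R) : 0 < e -> exists z, mdist x (i z) < e.
Proof.
move=> e0; have [_ di _] := iX.
have [] := di (interior (ball x e)).
- by exists x; exact: nbhsx_ballx.
- exact: open_interior.
- move=> y [/interior_subset + [z _ zy]]; rewrite ballEmdist/= => h.
  by exists z; rewrite zy.
Qed.

Lemma completion_lipschitz_id (f : Xb -> Xb) (K : R) :
  lipschitz_with mdist mdist setT f K -> (forall z, f (i z) = i z) -> forall x, f x = x.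
Proof.
move=> [K0 fK] fi x; apply: mdist_positivity.
apply/eqP; rewrite eq_le mdist_ge0 andbT; apply/ler_addgt0Pl => e e0; rewrite addr0.
have K1 : 0 < K + 1 by rewrite ltr_wpDl.
have [z xz] := completion_dense x (divr_gt0 e0 K1).
rewrite (le_trans (metric_triangle _ (i z) _))//.
apply: (@le_trans _ _ ((K + 1) * mdist x (i z))).
  rewrite mulrDl mul1r lerD//; last by rewrite metric_sym.
  by rewrite -{1}(fi z); exact: fK.
by rewrite mulrC -ler_pdivlMr// ltW.
Qed.

(** The value at x is the limit of the images of the points of X near x, a Cauchy filter because
    [psi] is Lipschitz. *)
Lemma lipschitz_completion (Y Yb : metricType R) (j : Y -> Yb) (psi : X -> Y) (L : R) :
  is_completion j -> 0 <= L -> (forall x y, mdist (psi x) (psi y) <= L * mdist x y) ->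
  exists2 psib : Xb -> Yb, lipschitz_with mdist mdist setT psib L &
    forall z, psib (i z) = j (psi z).
Proof.
move=> [jd _ jc] L0 psiL; have [id _ _] := iX.
have L1 : 0 < L + 1 by rewrite ltr_wpDl.
have jpsi z z' : mdist (j (psi z)) (j (psi z')) <= L * mdist (i z) (i z').
  by rewrite jd id.
(* This inequality is all that is kept of the limit: x = [i z] makes it an extension, and
   approximating a second point by some [i z] makes it L-Lipschitz. *)
have /choice[psib psibP] : forall x, exists y,
    forall z, mdist y (j (psi z)) <= L * mdist x (i z).
  move=> x.
  pose F : set_system Yb := filter_from [set e : R | 0 < e]
    (fun e => [set j (psi z) | z in [set z | mdist x (i z) < e]]).
  have FF : ProperFilter F.
    apply: filter_from_proper.
      apply: filter_from_filter; first by exists 1 => /=.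
      move=> e e' /= e0 e0'; exists (Num.min e e'); first by rewrite /= lt_min e0.
      by move=> y [z /=]; rewrite lt_min => /andP[? ?] <-; split; exists z.
    by move=> e /= /(completion_dense x)[z zx]; exists (j (psi z)), z.
  have [y Fy] : exists y : Yb, F --> y.
    apply: jc; apply/cauchyP => e e0.
    have e1 : 0 < e / (L + 1) / 2 by rewrite !divr_gt0.
    have [z0 z0x] := completion_dense x e1.
    exists (j (psi z0)); exists (e / (L + 1) / 2) => // _ [z /= zx <-].
    rewrite ballEmdist/= (le_lt_trans (jpsi _ _))//.
    apply: (@le_lt_trans _ _ ((L + 1) * mdist (i z0) (i z))).
      by rewrite ler_wpM2r ?mdist_ge0// lerDl.
    rewrite mulrC -ltr_pdivlMr// (le_lt_trans (metric_triangle _ x _))//.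
    by rewrite [ltRHS]splitr ltrD// metric_sym.
  exists y => z.
  apply/ler_addgt0Pl => e e0.
  have e1 : 0 < e / (L + 1) by rewrite divr_gt0.
  have [d /= d0 dF] := Fy _ (@nbhsx_ballx _ Yb y _ e1).
  have me : 0 < Num.min d (e / (L + 1)) by rewrite lt_min d0.
  have [z' ] := completion_dense x me; rewrite lt_min => /andP[z'd z'e].
  have : ball y (e / (L + 1)) (j (psi z')) by apply: dF; exists z'.
  rewrite ballEmdist/= => yz'.
  rewrite (le_trans (metric_triangle _ (j (psi z')) _))//.
  apply: (@le_trans _ _ (e / (L + 1) + L * (e / (L + 1) + mdist x (i z)))).
    rewrite lerD ?(ltW yz')// (le_trans (jpsi _ _))// ler_wpM2l//.
    by rewrite (le_trans (metric_triangle _ x _))// lerD2r metric_sym ltW.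
  have : (L + 1) * (e / (L + 1)) = e by rewrite mulrC divfK ?gt_eqF.
  by rewrite mulrDl mul1r mulrDr; lra.
exists psib; last first.
  move=> z; apply: mdist_positivity; apply/eqP; rewrite eq_le mdist_ge0 andbT.
  by have := psibP (i z) z; rewrite mdistxx mulr0.
split=> // x y _ _; apply/ler_addgt0Pl => e e0.
have e1 : 0 < e / (2 * (L + 1)) by rewrite divr_gt0// mulr_gt0.
have [z yz] := completion_dense y e1.
rewrite (le_trans (metric_triangle _ (j (psi z)) _))//.
apply: (@le_trans _ _ (L * (mdist x y + mdist y (i z)) + L * mdist y (i z))).
  rewrite lerD//; last by rewrite metric_sym.
  by rewrite (le_trans (psibP x z))// ler_wpM2l// metric_triangle.
rewrite mulrDr -addrA addrC lerD2r -mulrDl.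
apply: (@le_trans _ _ (2 * (L + 1) * mdist y (i z))).
  by rewrite ler_wpM2r ?mdist_ge0//; lra.
by rewrite mulrC -ler_pdivlMr ?mulr_gt0// ltW.
Qed.

End completion.

(** * Pushforward of integral currents *)

Section push_integral.
Context {R : realType}.
Implicit Types X Y : metricType R.

Definition option_current X n (o : option (chart X n)) : @functional R X n :=
  oapp (@chart_current R X n) (fun _ _ => 0) o.

Definition option_image X n (o : option (chart X n)) : set X :=
  oapp (@chart_image R X n) set0 o.

Definition option_is_chart X n (o : option (chart X n)) : Prop :=
  if o is Some d then is_chart d else True.

(** The least bound lies below the explicit chart bound, so it inherits concentration on the chart
    image. A missing chart is the zero functional, with the zero measure. *)
Lemma option_current_mass X n (o : option (chart X n)) : option_is_chart o ->
  [/\ fun_linear (option_current o), measurable (Some @` option_image o : set (borel X)) &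
    exists m, is_mass_measure (option_current o) m /\
      m (~` (Some @` option_image o)) = 0%E].
Proof.
case: o => [[U theta phi]|] /= co.
  have [/= mU _ theta_int [L L0 phiL]] := co.
  have lin := fun_linear_chart mU L0 phiL theta_int.
  have mE := measurable_chart_image mU L0 phiL.
  split=> //.
  have [m Sm mE0] := mass_bound_chart mU L0 phiL theta_int.
  have [mu Smu] := exists_mass_measure lin Sm.
  exists mu; split=> //; apply/eqP; rewrite -measure_le0 -mE0.
  by apply: Smu.2 => //; exact: measurableC.
rewrite image_set0; split=> //.
  by move=> a f g p _ _ _; rewrite /= mulr0 addr0.
exists mzero; split=> //; split; last by move=> nu _ A _; exact: measure_ge0.
split=> //; first by rewrite /= /mzero ltry.
by move=> f p _ _; rewrite integral_measure_zero mule0 normr0.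
Qed.

Lemma option_massE X n (o : option (chart X n)) :
  mass (option_current o) = oapp (fun d => mass (chart_current d)) 0%E o.
Proof.
case: o => //=; have [_ _ [m [Sm m0]]] := @option_current_mass X n None I.
rewrite -[fun _ _ => 0]/(option_current None) (massE Sm).
by move: m0; rewrite /= image_set0 setC0.
Qed.

Variables (X Y : metricType R) (n : nat) (psi : X -> Y) (phi : Y -> X) (L : R).
Hypothesis L0 : 0 < L.
Hypothesis psiL : lipschitz_with mdist mdist setT psi L.
Hypothesis phiL : lipschitz_with mdist mdist setT phi L.
Hypothesis psiK : cancel psi phi.

Definition push_chart (d : chart X n) : chart Y n :=
  Chart (chart_dom d) (chart_mult d) (psi \o chart_map d).

(** The lower distance bound comes from [phi], which is L-Lipschitz and undoes [psi]. *)
Lemma is_chart_push d : is_chart d -> is_chart (push_chart d).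
Proof.
move=> [mU pU theta_int [K K0 dK]]; split=> //.
exists (K * L); first exact: mulr_gt0.
move=> x y Ux Uy /=; have /andP[h1 h2] := dK x y Ux Uy; apply/andP; split.
  rewrite invfM mulrA ler_pdivrMr// (le_trans h1)// mulrC.
  by rewrite -{1}(psiK (chart_map d x)) -{1}(psiK (chart_map d y)); exact: phiL.2.
rewrite (le_trans (psiL.2 _ _ I I))// [K * L]mulrC -mulrA.
by rewrite ler_wpM2l// ltW.
Qed.

Lemma push_option_image o : option_image (omap push_chart o) = psi @` option_image o.
Proof.
by case: o => [d|]/=; rewrite ?image_set0//= /chart_image/= image_comp.
Qed.

Lemma push_option_current o :
  option_current (omap push_chart o) = push_current psi (option_current o).
Proof. by case: o => [d|]; rewrite /option_current/= /chart_current /push_current. Qed.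

Lemma push_mass_le (S : @functional R X n) mu nu : is_mass_measure S mu ->
  is_mass_measure (push_current psi S) nu -> (nu setT <= (L ^+ n)%:E * mu setT)%E.
Proof.
move=> Smu Snu; have [m Sm mE] := mass_bound_push psiL Smu.1.
by rewrite (le_trans (Snu.2 _ Sm _ measurableT))// mE preimage_setT.
Qed.

Lemma integer_rectifiable_push (T : @functional R X n) : is_current T ->
  integer_rectifiable T -> integer_rectifiable (push_current psi T).
Proof.
move=> Tc [c [cc tc cT massT]].
have c_chart k : option_is_chart (c k) by have := cc k; case: (c k).
pose c' k := omap push_chart (c k).
have c'_chart k : option_is_chart (c' k).
  rewrite /c'; have := cc k; case: (c k) => //= d; exact: is_chart_push.
have tc' : trivIset setT (fun k => option_image (c' k)).
  apply/trivIsetP => j k _ _ jk; rewrite !push_option_image.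
  apply/seteqP; split=> // _ [[x xj <-] [y yk yx]].
  have xy : y = x by rewrite -(psiK y) yx psiK.
  move/trivIsetP : tc => /(_ j k I I jk) h.
  have : (option_image (c j) `&` option_image (c k)) x by split=> //; rewrite -xy.
  by rewrite h.
have sumE (f : Y -> R) p :
    (fun N => \sum_(k < N) oapp (fun d => chart_current d f p) 0 (c' k)) =
    (fun N => \sum_(k < N)
       oapp (fun d => chart_current d (f \o psi) (fun i => p i \o psi)) 0 (c k)).
  by apply/funext => N; apply: eq_bigr => k _; rewrite /c'; case: (c k).
exists c'; split=> //.
- move=> f p bf lp.
  have := cT _ _ (bounded_lip_comp psiL bf) (fun i => lip_comp psiL (lp i)).
  by rewrite sumE.
have mass' k : exists m, is_mass_measure (option_current (c' k)) m /\
    m (~` (Some @` option_image (c' k))) = 0%E.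
  by have [] := option_current_mass (c'_chart k).
have /choice[m_ m_P] := mass'.
under eq_eseriesr do rewrite -option_massE.
have [mu Tmu] := current_mass_measure Tc.
apply: (@mass_series _ _ _ _ _ m_ (fun k => Some @` option_image (c' k))).
- exact: current_fun_linear (is_current_push psiL Tc).
- by move=> k; have [] := option_current_mass (c'_chart k).
- by move=> k; exact: (m_P k).1.
- by move=> k; have [] := option_current_mass (c'_chart k).
- apply/trivIsetP => j k _ _ jk; apply/seteqP; split=> // _ [[x xj <-] [y yk [yx]]].
  move/trivIsetP : tc' => /(_ j k I I jk) h.
  have : (option_image (c' j) `&` option_image (c' k)) x by split=> //; rewrite -yx.
  by rewrite h.
- by move=> k; exact: (m_P k).2.
(* Summability of the pushed masses: here the mass clause of [T] enters, each pushed mass being at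
   most L^n times the original one. *)
- apply: (@le_lt_trans _ _ ((L ^+ n)%:E * mass T)%E); last first.
    rewrite (massE Tmu) lte_mul_pinfty ?lee_fin ?exprn_ge0// ?(ltW L0)//.
    by have [[]] := Tmu.
  rewrite massT -nneseriesZl; last first.
    move=> k _; rewrite -option_massE; have [_ _ [m [Sm _]]] := option_current_mass (c_chart k).
    by rewrite (massE Sm).
  apply: lee_nneseries => // k _.
  rewrite -option_massE; have [_ _ [m [Sm _]]] := option_current_mass (c_chart k).
  rewrite (massE Sm); apply: push_mass_le Sm _.
  by rewrite -push_option_current; exact: (m_P k).1.
- move=> f p bf lp.
  have := cT _ _ (bounded_lip_comp psiL bf) (fun i => lip_comp psiL (lp i)).
  have oE : (fun N => \sum_(k < N) option_current (c' k) f p) =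
      (fun N => \sum_(k < N) oapp (fun d => chart_current d f p) 0 (c' k)).
    by apply/funext => N; apply: eq_bigr => k _; rewrite /option_current; case: (c' k).
  by rewrite oE sumE.
Qed.

End push_integral.

Lemma boundary_is_current_push (R : realType) (X Y : metricType R) n (psi : X -> Y) (L : R)
    (T : @functional R X n) : lipschitz_with mdist mdist setT psi L ->
  boundary_is_current T -> boundary_is_current (push_current psi T).
Proof.
move=> psiL; case: n T => //= n T Tb; rewrite boundary_push.
exact: is_current_push psiL Tb.
Qed.

(** The canonical set of the pushforward is the image of [psi] in the completion of Y; [psi_onto]
    makes this the whole of Y, and also supplies the inverse of [psi]. *)
Theorem theorem2p15 (R : realType) (n : nat)
  (X Xb : metricType R) (iX : X -> Xb) (T : functional Xb n)
  (Y Yb : metricType R) (iY : Y -> Yb) (psi : X -> Y)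
  (hT : integral_current_space iX T)
  (hY : is_completion iY)
  (hpsi : bilipschitz mdist mdist setT psi)
  (psi_onto : forall y, exists x, psi x = y) :
  exists psib : Xb -> Yb,
    [/\ continuous psib,
        forall x, psib (iX x) = iY (psi x) &
        integral_current_space iY (push_current psib T)].
Proof.
have [iXc [T_current T_rect T_bdry] T_set] := hT.
have [L L0 psiL] := hpsi.
have L_ge0 := ltW L0.
have psi_le x y : mdist (psi x) (psi y) <= L * mdist x y by have /andP[] := psiL x y I I.
have /choice[phi psiK] := psi_onto.
have phiL x y : mdist (phi x) (phi y) <= L * mdist x y.
  have /andP[h _] := psiL (phi x) (phi y) I I; move: h.
  by rewrite !psiK ler_pdivrMr// mulrC.
have phiK x : phi (psi x) = x.
  apply: mdist_positivity; apply/eqP; rewrite eq_le mdist_ge0 andbT.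
  have /andP[h _] := psiL (phi (psi x)) x I I; move: h.
  by rewrite psiK mdistxx ler_pdivrMr// mul0r.
have [psib psibL psibE] := lipschitz_completion iXc hY L_ge0 psi_le.
have [phib phibL phibE] := lipschitz_completion hY iXc L_ge0 phiL.
have psibK : cancel psib phib.
  apply: (completion_lipschitz_id iXc (K := L * L)) => [|z].
    split=> [|x y _ _]; first exact: mulr_ge0.
    rewrite -mulrA (le_trans (phibL.2 _ _ I I))// ler_wpM2l//.
    exact: psibL.2.
  by rewrite psibE phibE phiK.
have phibK : cancel phib psib.
  apply: (completion_lipschitz_id hY (K := L * L)) => [|z].
    split=> [|x y _ _]; first exact: mulr_ge0.
    rewrite -mulrA (le_trans (psibL.2 _ _ I I))// ler_wpM2l//.
    exact: phibL.2.
  by rewrite phibE psibE psiK.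
exists psib; split; [exact: lipschitz_with_continuous psibL|by []|].
have S_current := is_current_push psibL T_current.
split=> //.
  split=> //; first exact: (integer_rectifiable_push L0 psibL phibL psibK).
  exact: boundary_is_current_push psibL T_bdry.
set S := push_current psib T in S_current *.
(* [T] is in turn a pushforward of S, so [canonical_set_push] applies in both directions, with the
   roles of [psib] and [phib] exchanged. *)
have TE : push_current phib S = T.
  apply/funext => f; apply/funext => p; rewrite /S /push_current.
  congr T; first by apply/funext => x /=; rewrite psibK.
  by apply/funext => i; apply/funext => x /=; rewrite psibK.
have [muT TmuT] := current_mass_measure T_current.
have [muS SmuS] := current_mass_measure S_current.
apply/seteqP; split=> [y Sy|_ [y _ <-]].
  have : canonical_set T (phib y).
    exact: (canonical_set_push L0 psibL phibL psibK TmuT SmuS).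
  by rewrite T_set => -[z _ zy]; exists (psi z) => //; rewrite -psibE zy phibK.
rewrite -(psiK y) -psibE; apply: (canonical_set_push L0 phibL psibL phibK SmuS).
  by rewrite TE; exact: TmuT.
by rewrite TE T_set; exists (phi y).
Qed.
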